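(* Let $p$ be a prime and let $G$ be a realizable finite $p$-group. (1) If $G$ is almost cyclic, then $G$ is isomorphic to one of the following: $\mathbf{C}_2$, $\mathbf{C}_4$, $\mathbf{C}_8$, $\mathbf{C}_{q-1}$ ($q$ a Fermat prime), $\mathbf{C}_2\times\mathbf{C}_{2^n}$ ($n\ge 1$), $\mathbf{C}_p$ ($p$ a Mersenne prime), $\mathbf{C}_p\times\mathbf{C}_p$ ($p$ a Mersenne prime), $\mathbf{D}_8$, or $\mathbf{Q}_8$. (2) If $G$ has periodic cohomology, then $G$ is isomorphic to one of the following: $\mathbf{C}_2$, $\mathbf{C}_4$, $\mathbf{C}_8$, $\mathbf{C}_p$ ($p$ a Mersenne prime), $\mathbf{C}_{q-1}$ ($q$ a Fermat prime), or $\mathbf{Q}_8$.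
   Context: Rings are associative with identity, not necessarily commutative. A group is realizable if it is isomorphic to the group of units of some ring. $\mathbf{C}_m$ is the cyclic group of order $m$; $\mathbf{D}_8$ and $\mathbf{Q}_8$ are the dihedral group of order $8$ and the quaternion group of order $8$. A Fermat prime is an odd prime of the form $2^m+1$; a Mersenne prime is a prime of the form $2^m-1$. A $p$-group $G$ is almost cyclic if it has a cyclic subgroup of index $p$. A finite group $G$ has periodic (mod $p$) cohomology if there is a cohomology class $\eta\in H^d(G,\mathbb{F}_p)$ such that multiplication by $\eta$ gives an isomorphism $H^i(G,\mathbb{F}_p)\cong H^{i+d}(G,\mathbb{F}_p)$ for all $i>0$. (It is well known that a $p$-group has periodic mod $p$ cohomology if and only if it is a cyclic $p$-group or a generalized quaternion $2$-group.)
   Formalization: Part (2) is stated for nontrivial G (the trivial group, units of F_2, has vacuously periodic cohomology but is not listed), and periodic cohomology requires the class η to have positive degree d (with d = 0, η = 1 works for every group, and D_8 would violate (2)). *)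

(* Defs.v *)
From HB Require Import structures.
From mathcomp Require Import all_boot all_order all_fingroup all_algebra all_solvable.
From mathcomp Require Import generic_quotient ring_quotient.

Set Implicit Arguments.
Unset Strict Implicit.
Unset Printing Implicit Defensive.

Import GroupScope GRing.Theory.
Local Open Scope ring_scope.
Local Open Scope quotient_scope.

(* [pzRingType] is the type of arbitrary associative rings with identity; the *)
(* zero ring is included.                                                     *)
Definition is_unit (R : pzRingType) (u : R) : Prop :=
  exists v : R, v * u = 1 /\ u * v = 1.

Definition realizable (gT : finGroupType) (G : {set gT}) : Prop :=
  exists (R : pzRingType) (f : gT -> R),
    [/\ {in G &, forall x y, f (x * y)%g = f x * f y},
        {in G &, injective f}
      & forall u : R, is_unit u <-> exists2 x, x \in G & f x = u].

Definition almost_cyclic (p : nat) (gT : finGroupType) (G : {group gT}) : Prop :=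
  exists H : {group gT}, [/\ H \subset G, cyclic H & #|G : H|%g = p].

Definition fermat_prime (q : nat) : Prop :=
  [/\ prime q, odd q & exists m, q = (2 ^ m + 1)%N].

Definition mersenne_prime (q : nat) : Prop :=
  prime q /\ exists m, q = (2 ^ m - 1)%N.

(* Cohomology H^n(gT, F) with trivial coefficients, computed from the         *)
(* homogeneous bar cochains: gT-invariant functions of n + 1 group elements.  *)
Section Cohomology.

Variables (F : fieldType) (gT : finGroupType).

Definition simplex n := {ffun 'I_n.+1 -> gT}.
Definition cochain n := {ffun simplex n -> F^o}.

Definition face n (k : 'I_n.+2) (s : simplex n.+1) : simplex n :=
  [ffun t => s (lift k t)].

Definition cobd n (f : cochain n) : cochain n.+1 :=
  [ffun s => \sum_(k < n.+2) (-1) ^+ k * f (face k s)].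

Definition translate n (x : gT) (f : cochain n) : cochain n :=
  [ffun s : simplex n => f [ffun t => (x * s t)%g]].

Fact cobd_linear n : linear (@cobd n).
Proof.
move=> a f h; apply/ffunP=> s; rewrite !ffunE scaler_sumr -big_split /=.
by apply: eq_bigr => k _; rewrite !ffunE mulrDr scalerAr.
Qed.
HB.instance Definition _ n :=
  GRing.isLinear.Build F (cochain n) (cochain n.+1) _ (@cobd n) (@cobd_linear n).

Fact translate_linear n x : linear (@translate n x).
Proof. by move=> a f h; apply/ffunP=> s; rewrite !ffunE. Qed.
HB.instance Definition _ n x :=
  GRing.isLinear.Build F (cochain n) (cochain n) _ (@translate n x)
    (@translate_linear n x).

Definition invariant_cochains n : {vspace cochain n} :=
  (\bigcap_(x : gT) fixedSpace (linfun (@translate n x)))%VS.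

Definition cocycles n : {vspace cochain n} :=
  (invariant_cochains n :&: lker (linfun (@cobd n)))%VS.

Definition coboundaries n : {vspace cochain n} :=
  match n with
  | 0 => 0%VS
  | m.+1 => (linfun (@cobd m) @: invariant_cochains m)%VS
  end.

Definition cocycle n := subvs_of (cocycles n).

Definition trivial_cocycles n : {vspace cocycle n} :=
  (linfun (@vsval _ _ (cocycles n)) @^-1: coboundaries n)%VS.

Definition cohomology n := Quotient.quot (trivial_cocycles n).

Definition cohomology_class n (a : cocycle n) : cohomology n :=
  \pi_(cohomology n) a.

(* (s_m, ..., s_{m+k}); only meaningful for m + k <= n, because of [inord].   *)
Definition segment n (m k : nat) (s : simplex n) : simplex k :=
  [ffun t : 'I_k.+1 => s (inord (m + t))].

Definition cup i j (a : cochain i) (b : cochain j) : cochain (i + j) :=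
  [ffun s => a (segment 0 i s) * b (segment i j s)].

Lemma invariantP n (f : cochain n) :
  reflect (forall x, translate x f = f) (f \in invariant_cochains n).
Proof.
apply: (iffP idP) => [finv x | finv].
  have: f \in fixedSpace (linfun (@translate n x)).
    by apply: subvP finv; apply: bigcapv_inf (subvv _).
  by move/fixedSpaceP; rewrite lfunE.
rewrite memvE; apply/subv_bigcapP => x _; rewrite -memvE.
by apply/fixedSpaceP; rewrite lfunE; apply: finv.
Qed.

Lemma cocyclesP n (f : cochain n) :
  reflect ((forall x, translate x f = f) /\ cobd f = 0) (f \in cocycles n).
Proof.
rewrite memv_cap memv_ker lfunE /=.
by apply: (iffP andP) => [[/invariantP ? /eqP] | [/invariantP ? ->]].
Qed.

Lemma coboundariesSP n (f : cochain n.+1) :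
  reflect (exists2 h : cochain n, (forall x, translate x h = h) & f = cobd h)
          (f \in coboundaries n.+1).
Proof.
apply: (iffP memv_imgP) => [[h /invariantP hinv ->] | [h hinv ->]];
  by exists h; rewrite ?lfunE //; apply/invariantP.
Qed.

Lemma translate_cup i j x (a : cochain i) (b : cochain j) :
  translate x (cup a b) = cup (translate x a) (translate x b).
Proof.
by apply/ffunP=> s; rewrite !ffunE; congr (a _ * b _);
   apply/ffunP=> t; rewrite !ffunE.
Qed.

Lemma segment_full n (s : simplex n) : segment 0 n s = s.
Proof. by apply/ffunP=> t; rewrite ffunE add0n inord_val. Qed.

Lemma segment_segment n q m k (s : simplex n) :
  (m + k <= q)%N -> segment m k (segment 0 q s) = segment m k s.
Proof.
move=> le_q; apply/ffunP=> t; rewrite !ffunE add0n inordK // ltnS.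
by apply: leq_trans le_q; rewrite leq_add2l -ltnS.
Qed.

Lemma segment_face n m q k l (s : simplex n.+1) :
    (m + q <= n)%N -> (l < n.+2)%N -> (k < q.+2)%N ->
    (forall t, t <= q -> bump l (m + t) = m + bump k t)%N ->
  segment m q (face (inord l) s) = face (inord k) (segment m q.+1 s).
Proof.
move=> le_n lt_l lt_k eq_b; apply/ffunP=> t; rewrite !ffunE; congr (s _).
have le_t: (t <= q)%N by rewrite -ltnS.
have lt_t: (m + t < n.+1)%N by rewrite ltnS; apply: leq_trans le_n; rewrite leq_add2l.
have b_t: (bump k t <= q.+1)%N by exact: (leq_add (leq_b1 _) le_t).
apply: val_inj; rewrite /= !inordK // ?eq_b // ltnS.
by apply: leq_trans (_ : m + q.+1 <= _)%N; rewrite ?leq_add2l // addnS ltnS.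
Qed.

Lemma segment_face_shift n m m' q l (s : simplex n.+1) :
    (m + q <= n)%N -> (l < n.+2)%N ->
    (forall t, t <= q -> bump l (m + t) = m' + t)%N ->
  segment m q (face (inord l) s) = segment m' q s.
Proof.
move=> le_n lt_l eq_b; apply/ffunP=> t; rewrite !ffunE; congr (s _).
have le_t: (t <= q)%N by rewrite -ltnS.
have lt_t: (m + t < n.+1)%N by rewrite ltnS; apply: leq_trans le_n; rewrite leq_add2l.
apply: val_inj; rewrite /= !inordK // ?eq_b //.
by rewrite -eq_b //; rewrite ltnS; exact: (@leq_add _ _ 1 n (leq_b1 _)).
Qed.

Lemma cobdE n (f : cochain n) (s : simplex n.+1) :
  cobd f s = \sum_(0 <= k < n.+2) (-1) ^+ k * f (face (inord k) s).
Proof. by rewrite big_mkord ffunE; apply: eq_bigr => k _; rewrite inord_val. Qed.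

Lemma cobd_cup i j (a : cochain i) (b : cochain j) (s : simplex (i + j).+1) :
  cobd (cup a b) s =
    cobd a (segment 0 i.+1 s) * b (segment i.+1 j s)
    + (-1) ^+ i * (a (segment 0 i s) * cobd b (segment i j.+1 s)).
Proof.
rewrite !cobdE (big_cat_nat (n := i.+1)) //=; last by rewrite !ltnS leqW ?leq_addr.
rewrite [in X in _ = X * _ + _]big_nat_recr //= [in X in _ = _ + X]big_nat_recl //=.
rewrite mulrDl !mulrDr -!addrA; congr (_ + _).
  rewrite mulr_suml; apply: eq_big_nat => k /andP[_ lt_k]; rewrite ffunE mulrA.
  congr (_ * a _ * b _).
    apply: segment_face; rewrite ?add0n ?leq_addr //.
      by apply: leq_trans lt_k _; rewrite ltnS leqW ?leq_addr.
    by apply: leqW.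
  apply: segment_face_shift => // [|t _].
    by apply: leq_trans lt_k _; rewrite ltnS leqW ?leq_addr.
  by rewrite /bump (leq_trans _ (leq_addr t i)).
rewrite expr0 mul1r.
have ->: face (inord i.+1) (segment 0 i.+1 s) = segment 0 i s.
  rewrite -(@segment_face _ 0 i i.+1 i.+1 s) ?leq_addr //.
    apply: segment_face_shift; rewrite ?leq_addr // ?ltnS ?leq_addr //.
    by move=> t le_t; rewrite /bump add0n ltnNge le_t.
have ->: face (inord 0) (segment i j.+1 s) = segment i.+1 j s.
  rewrite -(@segment_face _ i j 0 i s) //.
  - apply: segment_face_shift; rewrite ?ltnS ?leqW ?leq_addr //.
    by move=> t _; rewrite /bump leq_addr.
  - by rewrite ltnS leqW ?leq_addr.
  by move=> t _; rewrite /bump leq_addr leq0n addnCA.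
rewrite exprS mulN1r !mulNr mulrA addKr -{1}[i.+1]add0n big_addn.
have -> : ((i + j).+2 - i.+1 = j.+1)%N by rewrite subSS -addnS addKn.
rewrite mulrA mulr_sumr; apply: eq_big_nat => l /andP[_ lt_l].
have lt_li: (l + i.+1 < (i + j).+2)%N by rewrite addnS addnC !ltnS leq_add2l.
rewrite ffunE; have ->: segment 0 i (face (inord (l + i.+1)) s) = segment 0 i s.
  apply: segment_face_shift => [||t le_t]; rewrite ?leq_addr //.
  by rewrite /bump addnS add0n ltnNge (leq_trans le_t) ?leq_addl.
have ->: segment i j (face (inord (l + i.+1)) s) =
         face (inord l.+1) (segment i j.+1 s).
  apply: segment_face => // t _.
  by rewrite /bump addnS -addSn [(l.+1 + i)%N]addnC leq_add2l addnCA.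
by rewrite addnS -addSn addnC exprD mulrACA.
Qed.

Fact cup_cocycle i j (a : cocycle i) (b : cocycle j) :
  cup (vsval a) (vsval b) \in cocycles (i + j).
Proof.
have /cocyclesP [ainv da] := subvsP a; have /cocyclesP [binv db] := subvsP b.
apply/cocyclesP; split=> [x|]; first by rewrite translate_cup ainv binv.
by apply/ffunP=> s; rewrite cobd_cup da db !ffunE mul0r !mulr0 addr0.
Qed.

Definition cup_cocycles i j (a : cocycle i) (b : cocycle j) : cocycle (i + j) :=
  Subvs (cup_cocycle a b).

Definition cup_class i j (a : cohomology i) (b : cohomology j) :
    cohomology (i + j) :=
  cohomology_class (cup_cocycles (repr a) (repr b)).

Lemma cohomology_class_eq n (a b : cocycle n) :
  (cohomology_class a == cohomology_class b) =
    (vsval a - vsval b \in coboundaries n).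
Proof.
by rewrite /cohomology_class -Quotient.idealrBE -memv_preim lfunE.
Qed.

Lemma coboundaryI n m (f : cochain n) (h : cochain m) :
    n = m.+1 -> (forall x, translate x h = h) ->
    (forall s, f (segment 0 n s) = cobd h s) ->
  f \in coboundaries n.
Proof.
move=> eq_n hinv; subst n => def_f; apply/coboundariesSP; exists h => //.
by apply/ffunP=> s; rewrite -def_f segment_full.
Qed.

Lemma cup_coboundaryl i j (a : cochain i) (b : cochain j) :
  a \in coboundaries i -> b \in cocycles j -> cup a b \in coboundaries (i + j).
Proof.
move=> + /cocyclesP[binv db]; case: i a => [|i] a.
  rewrite memv0 => /eqP->; suff ->: cup (0 : cochain 0) b = 0 by apply: mem0v.
  by apply/ffunP=> s; rewrite !ffunE mul0r.
case/coboundariesSP=> h hinv ->.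
apply: (@coboundaryI _ (i + j) _ (cup h b)) => // [x|s].
  by rewrite translate_cup hinv binv.
by rewrite cobd_cup db [X in _ = _ + _ * (_ * X)]ffunE !mulr0 addr0
           segment_full ffunE.
Qed.

Lemma cup_coboundaryr i j (a : cochain i) (b : cochain j) :
  a \in cocycles i -> b \in coboundaries j -> cup a b \in coboundaries (i + j).
Proof.
move=> /cocyclesP[ainv da]; case: j b => [|j] b.
  rewrite memv0 => /eqP->; suff ->: cup a (0 : cochain 0) = 0 by apply: mem0v.
  by apply/ffunP=> s; rewrite !ffunE mulr0.
case/coboundariesSP=> h hinv ->.
apply: (@coboundaryI _ (i + j) _ (cup ((-1) ^+ i *: a) h)); first exact: addnS.
  by move=> x; rewrite translate_cup linearZ /= hinv ainv.
move=> s; rewrite cobd_cup linearZ /= da scaler0 ffunE [X in _ = X * _ + _]ffunE.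
rewrite mul0r add0r !segment_segment ?leq_addr //.
by rewrite [X in _ = _ * (X * _)]ffunE mulrA mulrA -exprMn mulrNN mulr1 expr1n mul1r.
Qed.

Lemma cup_class_of i j (a : cocycle i) (b : cocycle j) :
  cup_class (cohomology_class a) (cohomology_class b) =
    cohomology_class (cup_cocycles a b).
Proof.
rewrite /cup_class; set x := repr _; set y := repr _.
have Bx: vsval x - vsval a \in coboundaries i.
  by rewrite -cohomology_class_eq; apply/eqP/reprK.
have By: vsval y - vsval b \in coboundaries j.
  by rewrite -cohomology_class_eq; apply/eqP/reprK.
apply/eqP; rewrite cohomology_class_eq /=.
have ->: cup (vsval x) (vsval y) - cup (vsval a) (vsval b) =
    cup (vsval x - vsval a) (vsval y) + cup (vsval a) (vsval y - vsval b).
  by apply/ffunP=> s; rewrite !ffunE mulrBl mulrBr addrA subrK.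
by apply: memvD; [apply: cup_coboundaryl | apply: cup_coboundaryr];
  rewrite ?subvsP.
Qed.

End Cohomology.

(* The degree [d] has to be positive: for [d = 0] the class [1] would always  *)
(* qualify.                                                                   *)
Definition has_periodic_cohomology (p : nat) (gT : finGroupType)
    (G : {group gT}) : Prop :=
  exists (d : nat) (eta : cohomology 'F_p (subg_of G) d),
    (0 < d)%N /\
    forall i, (0 < i)%N ->
      bijective (fun x : cohomology 'F_p (subg_of G) i => cup_class x eta).

(* Main.v *)
From HB Require Import structures.
Require Import Defs.
From mathcomp Require Import generic_quotient ring_quotient.
From mathcomp Require Import all_boot all_fingroup all_algebra all_solvable.
From mathcomp Require Import all_field.
From mathcomp Require Import ring zify.

Set Implicit Arguments.
Unset Strict Implicit.
Unset Printing Implicit Defensive.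

Import GRing.Theory.

(** Let [G] be the unit group of a ring [R], and a [p]-group.

    The basic device is to pass to the subring Z[x] of [R] generated by one
    element [x] of [G]. It is commutative, and its units are elements of [G]
    that commute with [x].

    Suppose that [p] is odd. Then -1, whose square is 1, must be 1, so [R] has
    characteristic 2. The ring Z[x] has no nonzero nilpotent element [b],
    because [1 + b] would have order 2. Hence Z[x] is a product of finite
    fields of characteristic 2; in one of them [x] keeps its order [p ^ k], and
    the number [2 ^ d - 1] of units of this field is a power of [p]. But a power
    of a prime that is of the form [2 ^ d - 1] is a first power, so [p] is a
    Mersenne prime and every nontrivial element of [G] has order [p]
    ([odd_units], [odd_realized]).

    Suppose that [p = 2] and that [x], of order [2 ^ k] with [k >= 3], generates
    its own centralizer in [G]. Then the units of Z[x] are exactly the powers of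
    [x]. Such a commutative ring cannot be of 2-power characteristic
    ([cyclic_units_two_nilpotent]); it cannot be of characteristic 0, as it
    contains the unit [1 + sqrt 2] ([cyclic_units_char]); and as it has only one
    involution, it is the product of a ring of characteristic 2 and of a ring
    of odd prime characteristic [q] ([odd_component]). In the second factor
    [1 + x] is a power of [x], therefore no ring endomorphism of it maps [x] to
    [- x]. Applied to the powers of the Frobenius map, this restricts [q] modulo
    powers of 2, and leaves two possibilities: [q = 2 ^ k + 1] is a Fermat
    prime, and [x] lies in the prime field of the second factor, or [q = 3] and
    [k = 3] ([odd_component_cases]). This settles the cyclic groups. It also
    shows that an element [y] of [G] that normalizes the group generated by [x],
    and whose square lies in it, commutes with [x] ([not_normalized]): in the
    first case the image of [x] in the second factor is central, and in the
    second case one more application of the same principle excludes two of the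
    three nontrivial automorphisms of a cyclic group of order 8, and a
    square-zero element of characteristic 3 excludes the last one. A
    nonabelian 2-group with a cyclic subgroup of index 2 has such [x] and [y],
    which do not commute, as soon as its order exceeds 8; so its order is 8. An
    abelian group with a cyclic subgroup of index 2 is cyclic or a product of
    this subgroup with a group of order 2. This proves the first assertion.

    For the second assertion, let [G] have periodic cohomology. The dimensions
    of its cohomology groups are then bounded. If [K] is normal of index [p] in
    [K'], then the [K]-invariant cochains have a filtration of length [p] whose
    quotients are all isomorphic to the [K']-invariant ones, so a bound [c] for
    [K'] yields the bound [p c] for [K] ([cohomology_le_step]); and every
    subgroup of a [p]-group is reached from the group by a chain of such steps.
    On the other hand, two commuting elements [s] and [t] of order [p] that
    generate different subgroups span a group whose cohomology is unbounded:
    the [m + 1] monomials of degree [m] in the two Bockstein classes are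
    linearly independent in degree [2 m] ([rank2_unbounded]). Hence [G] has a
    single subgroup of order [p], so that it is cyclic or generalized
    quaternion, and both cases are covered by what precedes. *)

(** * Squares modulo powers of 2 *)

(** As [y + 1] is twice an odd number, [2 ^ k] divides [y ^ 2 - 1] if and only
    if [2 ^ (k - 1)] divides [y - 1]. *)
Lemma sqrt1_mod_pow2 k y :
    (0 < k)%N -> y = 1 %[mod 4] -> 2 ^ k %| y ^ 2 - 1 ->
  2 ^ k %| y - 1 \/ y = 1 + 2 ^ k.-1 %[mod 2 ^ k].
Proof.
case: k => // k _ /eqP y1; have y_gt0 : 0 < y by case: y y1.
move: y1; rewrite eqn_mod_dvd // => /dvdnP[a aE].
have -> : y ^ 2 - 1 = (y - 1) * (2 * a).+1 * 2 by nia.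
rewrite expnSr dvdn_pmul2r // Gauss_dvdl; last first.
  by rewrite coprimeXl // coprime2n /= mul2n odd_double.
case/dvdnP=> b bE; have [odd_b|even_b] := boolP (odd b); [right | left].
  have -> : y = b./2 * (2 ^ k * 2) + (1 + 2 ^ k).
    by rewrite -(subnK y_gt0) bE -{1}[b]odd_double_half odd_b; lia.
  by rewrite modnMDl.
by rewrite bE -[b]even_halfK // -muln2 -mulnA [2 * _]mulnC dvdn_mull.
Qed.

(** The powers [q ^ (2 ^ i)] tend to 1 in the 2-adic topology. One descends from
    a large [i] by taking square roots: the root 1 is the only one possible, the
    other root [1 + 2 ^ (k - 1)] being excluded, as long as the root is 1 modulo
    4. This is the case for [i > 0], since odd squares are 1 modulo 4. *)
Lemma pow2_dvd_sqrm1 k q :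
    (0 < k)%N -> odd q ->
    (forall j, q ^ j <> 1 + 2 ^ k.-1 %[mod 2 ^ k]) ->
  (2 ^ k %| q ^ 2 - 1) /\ (q = 1 %[mod 4] -> 2 ^ k %| q - 1).
Proof.
move=> k_gt0 odd_q q_neq; have q_gt0 : 0 < q by case: q odd_q {q_neq}.
have top i : 2 ^ i.+1 %| q ^ (2 ^ i) - 1.
  elim: i => [|i IH]; first by rewrite expn1 dvdn2 oddB // odd_q.
  rewrite [2 ^ i.+1]expnSr expnM; set a := q ^ _ in IH *.
  have odd_a : odd a by rewrite oddX odd_q orbT.
  have -> : a ^ 2 - 1 = (a - 1) * (a + 1) by nia.
  by rewrite expnSr dvdn_mul // dvdn2 oddD odd_a.
have step i : q ^ (2 ^ i) = 1 %[mod 4] -> 2 ^ k %| q ^ (2 ^ i.+1) - 1 ->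
    2 ^ k %| q ^ (2 ^ i) - 1.
  move=> q1; rewrite expnSr expnM => /(sqrt1_mod_pow2 k_gt0 q1)[//|].
  by move/q_neq.
have mod4 i : q ^ (2 ^ i.+1) = 1 %[mod 4].
  apply/eqP; rewrite eqn_mod_dvd ?expn_gt0 ?q_gt0 //; apply: dvdn_trans (top i.+1).
  by rewrite -[4]/(2 ^ 2) dvdn_exp2l.
have down n : 2 ^ k %| q ^ (2 ^ n.+1) - 1 -> 2 ^ k %| q ^ 2 - 1.
  by elim: n => // n IH /(step _ (mod4 n))/IH.
have dvd2 : 2 ^ k %| q ^ 2 - 1.
  by apply: (down k); apply: dvdn_trans (top k.+1); rewrite dvdn_exp2l // leqW.
by split=> // q1; have := step 0; rewrite expn0 expn1; apply.
Qed.

(** The order of 2 modulo [q] divides both a power of 2 and [q - 1], which is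
    twice an odd number. So it divides 2, and [q] divides [2 ^ 2 - 1]. *)
Lemma eq3_of_pow2_order k q :
  prime q -> q = 3 %[mod 4] -> q %| 2 ^ (2 ^ k) - 1 -> q = 3.
Proof.
move=> q_pr q3 q_dvd.
have odd_q : odd q by case: (even_prime q_pr) q3 => [->|].
have q_gt2 : 2 < q by apply: odd_prime_gt2.
have := @Euler_exp_totient 2 q; rewrite coprime2n odd_q totient_prime // => /(_ isT) eul.
have zE m : ((2%:R : 'F_q) ^+ m == 1)%R = (q %| 2 ^ m - 1).
  rewrite -natrX -subr_eq0 -(natrB _ (_ : 1 <= _)) ?expn_gt0 //.
  by rewrite -(dvdn_pcharf (pchar_Fp q_pr)).
have /eqP/prim_order_exists[|m prim_m m2] := etrans (zE _) q_dvd; first exact: expn_gt0.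
have m_q : m %| q.-1.
  by rewrite (prim_order_dvd prim_m) zE -eqn_mod_dvd ?expn_gt0 ?eul.
have : m %| 2.
  have <- : gcdn q.-1 (2 ^ k.+1) = 2.
    have [a aE] : exists a, q.-1 = (2 * a).+1 * 2.
      exists (q %/ 4); have := divn_eq q 4; rewrite q3; lia.
    by rewrite aE expnSr -muln_gcdl (eqP (_ : coprime _ _)) ?mul1n // coprimeXr // coprimen2 /= mul2n odd_double.
  by rewrite dvdn_gcd m_q expnS dvdn_mull.
rewrite (prim_order_dvd prim_m) zE => /dvdn_leq; move: q3 q_gt2; rewrite (_ : 2 ^ 2 - 1 = 3) //.
by move=> _ q_gt2 /(_ isT) q_le3; apply/eqP; rewrite eqn_leq q_le3.
Qed.

Local Open Scope ring_scope.

(** * Commutative rings whose units form a cyclic 2-group *)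

Lemma unit_1B_nilpotent (S : comNzRingType) (a : S) n :
  a ^+ n = 0 -> exists v, (1 - a) * v = 1.
Proof.
move=> an0; exists (\sum_(i < n) a ^+ i).
by rewrite -[1 - a]opprB mulNr -subrX1 an0 sub0r opprK.
Qed.

Lemma coprime_natr_torsion (R : nzRingType) (a : R) m1 m2 :
  coprime m1 m2 -> m1%:R * a = 0 -> m2%:R * a = 0 -> a = 0.
Proof.
move=> co a1 a2; have [m1_0|m1_gt0] := posnP m1.
  by move: co a2; rewrite m1_0 /coprime gcd0n => /eqP->; rewrite mul1r.
have [i j ij _] := egcdnP m2 m1_gt0.
have : (i * m1)%:R * a = (j * m2 + 1)%:R * a by rewrite ij (eqP co).
by rewrite natrD !natrM mulrDl mul1r -!mulrA a1 a2 !mulr0 add0r.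
Qed.

Lemma exp_1D_square0 (R : nzRingType) (a : R) m :
  a * a = 0 -> (1 + a) ^+ m = 1 + m%:R * a.
Proof.
move=> aa; elim: m => [|m IH]; first by rewrite mul0r addr0.
rewrite exprSr IH -natr1 mulrDr mulr1 mulrDl mul1r -mulrA aa mulr0 addr0.
by rewrite mulrDl mul1r addrA.
Qed.

Lemma prim_root_pow2 (S : nzRingType) (x : S) k :
  (0 < k)%N -> x ^+ (2 ^ k) = 1 -> x ^+ (2 ^ k.-1) != 1 -> (2 ^ k).-primitive_root x.
Proof.
case: k => // k _ xk xk1; have [|m prim_m] := prim_order_exists _ xk; first exact: expn_gt0.
case/(dvdn_pfactor _ _ (isT : prime 2)) => j; rewrite leq_eqVlt => /predU1P[-> <- //|lt_j mE].
by case/eqP: xk1; apply/eqP; rewrite -(prim_order_dvd prim_m) mE dvdn_exp2l.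
Qed.

Lemma coprime_inv_mod i n : coprime i n -> (0 < n)%N -> exists j, i * j = 1 %[mod n].
Proof.
move=> co_in n_gt0; exists (i ^ (totient n).-1)%N.
by rewrite -expnS prednK ?totient_gt0 // Euler_exp_totient.
Qed.

(** Put [pi = 1 - x]. As squaring is additive modulo 2, [pi ^ (2 ^ k)] is a
    multiple of 2, so [pi] is nilpotent, and factors [1 - pi y] may be cancelled.
    Moreover 2 is a multiple of [pi ^ 2]: if it is not 0, then
    [y = x ^ (2 ^ (k - 2))] is a square root of -1, so [2 = y (1 - y) ^ 2], and
    [1 - y] is a multiple of [pi]. Consequently [x ^ 2] is 1 plus a unit times
    [pi ^ 2], and [x ^ 4] is 1 modulo [pi ^ 4]. Now the unit [1 - pi ^ 3] has to
    be a power [x ^ i]. Comparing both sides gives [pi = 0], [pi ^ 2 = 0] or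
    [pi ^ 3 = 0], according to whether [i] is odd, twice odd or divisible by 4.
    In any case [pi ^ 3 = 0] and [x ^ 4 = 1], although [x] has order at least 8. *)
Lemma cyclic_units_two_nilpotent (S : comNzRingType) (x : S) k m :
    (2 < k)%N -> (2 ^ k).-primitive_root x ->
    (forall u v : S, u * v = 1 -> exists i, u = x ^+ i) ->
    (2%:R : S) = 0 \/ x ^+ (2 ^ k.-1) = -1 ->
  (2%:R : S) ^+ m != 0.
Proof.
move=> k_gt2 prx unit_x neg1; apply/eqP => two_nil.
have k_gt0 : (0 < k)%N by apply: leq_trans k_gt2.
have frob j : exists w, (1 - x) ^+ (2 ^ j) = 1 - x ^+ (2 ^ j) + 2%:R * w.
  elim: j => [|j [w IH]]; first by exists 0; rewrite !expr1 mulr0 addr0.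
  exists (x ^+ (2 ^ j) ^+ 2 - x ^+ (2 ^ j) + 2%:R * w * (1 - x ^+ (2 ^ j)) + 2%:R * w ^+ 2).
  by rewrite !expnSr !exprM IH; ring.
have pi_nil : (1 - x) ^+ (2 ^ k * m) = 0.
  have [w wE] := frob k; rewrite exprM wE (prim_expr_order prx) subrr add0r.
  by rewrite exprMn two_nil mul0r.
set pi := 1 - x in pi_nil frob; have xE : x = 1 - pi by rewrite opprB addrC subrK.
have nil_unit y : exists v, (1 - pi * y) * v = 1.
  by apply: (@unit_1B_nilpotent _ _ (2 ^ k * m)); rewrite exprMn pi_nil mul0r.
have [v twoE] : exists v, 2%:R = pi ^+ 2 * v.
  case: neg1 => [-> | xN1]; first by exists 0; rewrite mulr0.
  pose y := x ^+ (2 ^ k.-2).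
  have y2 : y * y = -1 by rewrite -expr2 /y -exprM -expnSr prednK // -ltnS prednK // ltnW.
  have [a aE] : exists a, 1 - y = pi * a.
    exists (\sum_(i < 2 ^ k.-2) x ^+ i).
    by rewrite /pi -[1 - x]opprB mulNr -subrX1 opprB.
  exists (y * a ^+ 2); transitivity (y * (1 - y) ^+ 2); last by rewrite aE; ring.
  by transitivity (y - 2%:R * (y * y) + y * y * y); [rewrite y2 | ]; ring.
have x2E : x ^+ 2 = 1 + pi ^+ 2 * (1 - pi * v).
  rewrite xE; transitivity (1 - 2%:R * pi + pi ^+ 2); first by ring.
  by rewrite twoE; ring.
have [w x4E] : exists w, x ^+ 4 = 1 + pi ^+ 4 * w.
  exists (v * (1 - pi * v) + (1 - pi * v) ^+ 2).
  rewrite (exprM x 2 2) x2E; set t := 1 - pi * v.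
  transitivity (1 + 2%:R * (pi ^+ 2 * t) + pi ^+ 4 * t ^+ 2); first by ring.
  by rewrite twoE; ring.
have pow1 (z y : S) n : exists t, (1 + z * y) ^+ n = 1 + z * t.
  elim: n => [|n [t tE]]; first by exists 0; rewrite mulr0 addr0.
  by exists (t + y + z * t * y); rewrite exprSr tE; ring.
have canc z y : z * (1 - pi * y) = 0 -> z = 0.
  by move=> zy; have [t tE] := nil_unit y; rewrite -[z]mulr1 -tE mulrA zy mul0r.
suff pi3 : pi ^+ 3 = 0.
  have : x ^+ 4 = 1 by rewrite x4E (exprS _ 3) pi3 mulr0 mul0r addr0.
  move/eqP; rewrite -(prim_order_dvd prx) -[4%N]/(2 ^ 2)%N dvdn_Pexp2l //.
  by rewrite leqNgt k_gt2.
have [u uE] := nil_unit (pi ^+ 2).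
have [|i xiE] := unit_x (1 - pi ^+ 3) u; first by rewrite exprS.
(* Raising to an inverse of [b] modulo the order of [x] recovers [x ^ a]. *)
have pow_odd a b : odd b -> i = (a * b)%N -> exists t, x ^+ a = 1 + pi ^+ 3 * t.
  move=> odd_b iE; have [||j jE] := @coprime_inv_mod b (2 ^ k).
  - by rewrite coprimeXr // coprimen2.
  - by rewrite expn_gt0.
  have [t tE] := pow1 (pi ^+ 3) (- 1) j; exists t; rewrite -tE mulrN1 xiE iE -exprM.
  by apply/eqP; rewrite (eq_prim_root_expr prx) -mulnA -modnMmr jE modnMmr muln1.
have [odd_i|even_i] := boolP (odd i).
  have [t xE'] := pow_odd 1%N i odd_i (esym (mul1n i)).
  suff -> : pi = 0 by rewrite expr0n.
  by apply: (canc _ (- (pi * t))); move/eqP: xE'; rewrite eq_sym -subr_eq0 expr1 {1}xE => /eqP <-; ring.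
have iE : i = (2 * i./2)%N by rewrite mul2n even_halfK.
have [odd_i2|even_i2] := boolP (odd i./2).
  have [t xE'] := pow_odd 2%N _ odd_i2 iE.
  suff pi2 : pi ^+ 2 = 0 by rewrite exprS pi2 mulr0.
  by apply: (canc _ (v + t)); move/eqP: xE'; rewrite -subr_eq0 x2E => /eqP <-; ring.
have i4E : i = (4 * i./2./2)%N by rewrite {1}iE -{1}[i./2]even_halfK // -mul2n mulnA.
have [t tE] := pow1 (pi ^+ 4) w i./2./2.
rewrite {1}i4E exprM x4E tE in xiE.
by apply: (canc _ (- t)); move/eqP: xiE; rewrite eq_sym -subr_eq0 => /eqP <-; ring.
Qed.

Section CyclicUnits.

Variables (S : comNzRingType) (x : S) (k : nat).
Hypotheses (k_gt2 : (2 < k)%N) (prx : (2 ^ k).-primitive_root x).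
Hypothesis unit_x : forall u v : S, u * v = 1 -> exists i, u = x ^+ i.

Let k_gt0 : (0 < k)%N. Proof. exact: leq_trans k_gt2. Qed.
Let kE : (2 ^ k = 2 ^ k.-1 * 2)%N. Proof. by rewrite -expnSr prednK. Qed.

Lemma involution_eq (u : S) : u * u = 1 -> u = 1 \/ u = x ^+ (2 ^ k.-1).
Proof.
move=> uu; have [i uE] := unit_x uu; move: uu; rewrite uE -exprD addnn -mul2n mulnC.
move/eqP; rewrite -(prim_order_dvd prx) kE dvdn_pmul2r // => /dvdnP[j ->].
have sq1 : (x ^+ (2 ^ k.-1)) ^+ 2 = 1 by rewrite -exprM -kE (prim_expr_order prx).
rewrite mulnC exprM; have [odd_j|even_j] := boolP (odd j); [right | left].
  rewrite -[j]odd_double_half odd_j exprS -mul2n exprM sq1.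
  by rewrite expr1n mulr1.
by rewrite -[j]even_halfK // -mul2n exprM sq1 expr1n.
Qed.

Lemma neg1_cases : (2%:R : S) = 0 \/ x ^+ (2 ^ k.-1) = -1.
Proof.
have [N1|->] := @involution_eq (-1) (etrans (mulrNN _ _) (mulr1 _)).
  by left; rewrite -[2%:R]/(1 + 1 : S) -{1}N1 addNr.
by right.
Qed.

Lemma two_not_nilpotent m : (2%:R : S) ^+ m != 0.
Proof. exact: cyclic_units_two_nilpotent k_gt2 prx unit_x neg1_cases. Qed.

Lemma two_neq0 : (2%:R : S) != 0.
Proof. exact: (two_not_nilpotent 1). Qed.

Lemma expr_half_order : x ^+ (2 ^ k.-1) = -1.
Proof. by case: neg1_cases => // two0; case/eqP: two_neq0. Qed.

(** An element [z] of order 8 yields a square root [s = z + z^-1] of 2, hence the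
    unit [1 + s]. As it is a power of [x], its order is finite:
    [(1 + s) ^ (2 ^ k) = A + B s = 1], where [A ^ 2 = 2 B ^ 2 + 1] and [A > 1].
    Eliminating [s] leaves [2 (A - 1) = 0]. *)
Lemma cyclic_units_char : exists2 n, (0 < n)%N & n%:R = 0 :> S.
Proof.
have [z z4] : exists z : S, z ^+ 4 = -1.
  exists (x ^+ (2 ^ (k - 3))); rewrite -exprM -[4%N]/(2 ^ 2)%N -expnD.
  by rewrite -expr_half_order; congr (x ^+ (2 ^ _)); lia.
(* This is [z + z^-1], because [z ^ 4 = -1]. *)
pose s := z - z ^+ 3; have s2 : s * s = 2%:R.
  transitivity (z ^+ 2 - 2%:R * z ^+ 4 + z ^+ 2 * z ^+ 4); first by rewrite /s; ring.
  by rewrite z4; ring.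
have [|j uE] := @unit_x (1 + s) (s - 1).
  by transitivity (s * s - 1); [ring | rewrite s2; ring].
have pow j' : exists A B, [/\ (A ^ 2 = 2 * B ^ 2 + 1)%N, (1 < A)%N &
    (1 + s) ^+ (2 ^ j'.+1) = A%:R + B%:R * s].
  elim: j' => [|j' [A [B [AB A_gt1 IH]]]].
    exists 3, 2; split=> //; transitivity (1 + 2%:R * s + s * s); first by ring.
    by rewrite s2; ring.
  exists (A ^ 2 + 2 * B ^ 2)%N, (2 * A * B)%N; split; [|by lia|].
    have -> : ((2 * A * B) ^ 2 = 4 * A ^ 2 * B ^ 2)%N by rewrite !expnMn.
    by rewrite AB; ring.
  rewrite expnSr exprM IH !natrD !natrX !natrM.
  transitivity (A%:R ^+ 2 + B%:R ^+ 2 * (s * s) + 2%:R * A%:R * B%:R * s); first by ring.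
  by rewrite s2; ring.
have [A [B [AB A_gt1]]] := pow k.-1.
rewrite prednK // uE -exprM mulnC exprM (prim_expr_order prx) expr1n => one_eq.
exists (2 * (A - 1))%N; first by rewrite muln_gt0 subn_gt0.
have AB' : (A%:R ^+ 2 : S) = 2%:R * B%:R ^+ 2 + 1 by rewrite -!natrX AB natrD natrM natrX.
have Bs : B%:R * s = 1 - A%:R by apply/eqP; rewrite eq_sym subr_eq addrC -one_eq.
have : (B%:R * s) ^+ 2 = 2%:R * B%:R ^+ 2.
  by transitivity (B%:R ^+ 2 * (s * s)); [ring | rewrite s2 mulrC].
rewrite Bs natrM natrB ?(ltnW A_gt1) // => eqA.
have : (A%:R ^+ 2 : S) = (1 - A%:R) ^+ 2 + 1 by rewrite eqA AB'.
move/eqP; rewrite -subr_eq0 => /eqP eq0; rewrite -eq0; ring.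
Qed.

(** The order of the unit [1 + a] divides the odd number [m] and is a power
    of 2. *)
Lemma square0_natmul (a : S) m : a * a = 0 -> m%:R * a = 0 -> odd m -> a = 0.
Proof.
move=> aa ma odd_m.
have [|i uE] := @unit_x (1 + a) (1 - a).
  by transitivity (1 - a * a); [ring | rewrite aa subr0].
have /eqP := exp_1D_square0 m aa; rewrite ma addr0 uE -exprM -(prim_order_dvd prx).
rewrite Gauss_dvdl ?coprimeXl ?coprime2n // (prim_order_dvd prx) -uE.
by rewrite -subr_eq0 addrC addKr => /eqP.
Qed.

(** The characteristic [n] has an odd prime factor [q], since 2 is not nilpotent,
    and [q] divides [n] only once, since otherwise the square of [n / q] would be
    0 in [S]. By the Chinese remainder theorem, some integer [c] is an idempotent
    of [S] whose factor [c S] has characteristic [q]. The involution [1 - 2 c] is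
    not 1, so it is -1, the only other one: the complementary factor has
    characteristic 2, or is 0. *)
Lemma odd_component : exists q c : nat,
  [/\ prime q, odd q, c%:R * c%:R = c%:R :> S, 2%:R * c%:R = 2%:R :> S
    & forall m, (m%:R * c%:R == 0 :> S) = (q %| m)%N].
Proof.
have ex_n : exists n, (0 < n)%N && (n%:R == 0 :> S).
  by have [n n_gt0 /eqP n0] := cyclic_units_char; exists n; rewrite n_gt0.
case: (ex_minnP ex_n) => n /andP[n_gt0 /eqP n0] n_min.
have natr0 m : (m%:R == 0 :> S) = (n %| m)%N.
  apply/idP/idP => [m0|/dvdnP[j ->]]; last by rewrite natrM n0 mulr0.
  rewrite /dvdn; case: posnP => // mod_gt0.
  have /n_min : (0 < m %% n)%N && ((m %% n)%:R == 0 :> S).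
    rewrite mod_gt0 -(eqP m0) {2}(divn_eq m n) natrD natrM n0 mulr0 add0r eqxx //.
  by rewrite leqNgt ltn_pmod.
have [q q_pr /andP[odd_q q_n]] : exists2 q, prime q & odd q && (q %| n)%N.
  have [/allP n2|/allPn[q]] := boolP (all (pred1 2) (primes n)); last first.
    rewrite mem_primes => /and3P[q_pr _ qn] q2; exists q => //; rewrite qn andbT.
    by case: (even_prime q_pr) q2 => [->|].
  case/eqP: (two_not_nilpotent (logn 2 n)); apply/eqP; rewrite -natrX natr0.
  rewrite -p_part part_pnat_id //; apply/pnatP => // q q_pr qn.
  by have := n2 q; rewrite mem_primes q_pr n_gt0 qn => /(_ isT).
have [n' nE] := dvdnP q_n.
have n'_gt0 : (0 < n')%N by move: n_gt0; rewrite nE muln_gt0 => /andP[].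
have co_qn' : coprime q n'.
  rewrite prime_coprime //; apply/negP => /dvdnP[m mE].
  have /eqP : (n'%:R : S) = 0.
    apply: (@square0_natmul _ q) => //.
      by apply/eqP; rewrite -natrM natr0 nE {2}mE -mulnA dvdn_mull // [(q * n')%N]mulnC.
    by rewrite -natrM mulnC -nE.
  rewrite natr0 nE => /dvdn_leq; rewrite n'_gt0 => /(_ isT).
  by rewrite leqNgt ltn_Pmulr ?prime_gt1.
pose c := chinese q n' 1 0; exists q, c.
have c_q : c = 1 %[mod q] := chinese_modl co_qn' 1 0.
have c_n' : (n' %| c)%N by rewrite /dvdn (chinese_modr co_qn' 1 0) mod0n.
have dvd_c m : (m%:R * c%:R == 0 :> S) = (q %| m)%N.
  rewrite -natrM natr0 nE Gauss_dvd 1?coprime_sym // (dvdn_mull m c_n') /=.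
  by rewrite /dvdn -modnMmr c_q modnMmr muln1.
have cc : c%:R * c%:R = c%:R :> S.
  have c_gt0 : (0 < c)%N.
    by rewrite lt0n; apply: contra_eqN c_q => /eqP->; rewrite mod0n modn_small ?prime_gt1.
  apply/eqP; rewrite -subr_eq0 -{3}[c%:R]mul1r -mulrBl -[1]/(1%:R) -natrB // dvd_c.
  by rewrite -eqn_mod_dvd // c_q.
split=> //.
have [|u1|] := @involution_eq (1 - 2%:R * c%:R).
- by transitivity (1 - 4%:R * c%:R + 4%:R * (c%:R * c%:R) : S); [ring | rewrite cc; ring].
- have /eqP : 2%:R * c%:R = 0 :> S by move/eqP: u1; rewrite eq_sym -subr_eq0 => /eqP<-; ring.
  rewrite dvd_c => /dvdn_leq => /(_ isT); rewrite leqNgt odd_prime_gt2 //.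
rewrite expr_half_order => /eqP; rewrite -subr_eq0 => /eqP u1.
by apply/eqP; rewrite eq_sym -subr_eq0 -u1; apply/eqP; ring.
Qed.

Variables (q : nat) (e : S).
Hypotheses (q_pr : prime q) (odd_q : odd q) (ee : e * e = e) (e2 : 2%:R * e = 2%:R).
Hypothesis dvd_e : forall m, (m%:R * e == 0) = (q %| m)%N.

(** A unit of the factor [e S] becomes a unit of [S] by adding [1 - e]. *)
Lemma lift_unit t w : e * t * w = e -> exists i, e * t = e * x ^+ i.
Proof.
move=> etw; have [|i iE] := @unit_x (e * t + (1 - e)) (e * w + (1 - e)).
  transitivity (1 + (e * e) * t * w - e + (e * e - e) * (1 - t - w)); first by ring.
  by rewrite ee subrr mul0r addr0 etw addrK.
exists i; rewrite -iE; transitivity (e * e * t + (e - e * e)); last by ring.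
by rewrite ee subrr addr0.
Qed.

(** [1 + x] divides [1 - x ^ (2 ^ (k - 1)) = 2], which has the inverse
    [(q + 1) / 2] in the factor [e S] of characteristic [q]. *)
Lemma unit_1Dx : exists i, e * (1 + x) = e * x ^+ i.
Proof.
apply: (@lift_unit _ ((q.+1)./2%:R * \sum_(j < 2 ^ k.-1) (- x) ^+ j)).
have -> : e * (1 + x) * (q.+1./2%:R * \sum_(j < 2 ^ k.-1) (- x) ^+ j) =
    (- q.+1./2%:R * e) * ((- x - 1) * \sum_(j < 2 ^ k.-1) (- x) ^+ j) by ring.
rewrite -subrX1 exprNn -signr_odd oddX orbF.
have -> : (k.-1 == 0)%N = false by apply/negbTE; rewrite -lt0n -ltnS prednK // ltnW.
rewrite expr0 mul1r expr_half_order.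
have -> : - q.+1./2%:R * e * (-1 - 1) = (q.+1./2 * 2)%:R * e by rewrite natrM; ring.
rewrite muln2 even_halfK /= ?odd_q // -natr1 mulrDl mul1r.
by have /eqP-> : q%:R * e == 0; rewrite ?dvd_e ?add0r.
Qed.

(** All multiples of 2 lie in [e S]. *)
Lemma e_double t : e * t + e * t = 0 -> t + t = 0.
Proof.
move=> tt; transitivity (2%:R * t); first by ring.
by rewrite -e2 -tt; ring.
Qed.

(** Under a ring endomorphism of [e S] that maps [x] to [- x], the first equation
    would give the second one, that is [1 - x = 1 + x] or [1 - x = - (1 + x)]
    in [e S], so that [2 x = 0] or [2 = 0]. *)
Lemma no_negation i : e * (1 + x) = e * x ^+ i -> e * (1 - x) <> e * (- x) ^+ i.
Proof.
move=> xi; rewrite exprNn => nxi.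
have two0 : (1 + 1 : S) != 0 by exact: two_neq0.
have {nxi} : e * (1 - x) = (-1) ^+ i * (e * (1 + x)) by rewrite nxi xi mulrCA.
rewrite -signr_odd; case: odd; rewrite ?expr1 ?expr0 ?mul1r => eqx; case/eqP: two0.
  apply: e_double; move/eqP: eqx; rewrite -subr_eq0 => /eqP<-; ring.
have /e_double xx : e * x + e * x = 0.
  by move/eqP: eqx; rewrite eq_sym -subr_eq0 => /eqP<-; ring.
have [j jx] : exists j, j * x = 1.
  by exists (x ^+ (2 ^ k).-1); rewrite -exprSr prednK ?expn_gt0 // (prim_expr_order prx).
by rewrite -jx -mulrDr xx mulr0.
Qed.

Lemma idem_exp (a b : S) m : e * a = e * b -> e * a ^+ m = e * b ^+ m.
Proof.
move=> ab; case: m => // m.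
have E : forall t, e * t ^+ m.+1 = (e * t) ^+ m.+1.
  move=> t; rewrite exprMn; congr (_ * _).
  by elim: m => // m IH; rewrite exprS -IH ee.
by rewrite !E ab.
Qed.

Lemma idem_frobenius y : e * (1 + y) ^+ q = e * (1 + y ^+ q).
Proof.
have q_gt0 := prime_gt0 q_pr.
rewrite exprDn (bigD1 ord0) //= (bigD1 ord_max) -?val_eqE /= -?lt0n //.
rewrite subnn subn0 bin0 binn !expr1n expr0 mulr1 mul1r !mulr1n addrA mulrDr.
rewrite [X in _ + X](_ : _ = 0) ?addr0 // mulr_sumr big1 // => i.
rewrite -!val_eqE /= => /andP[i_neq0 i_neqq].
have /dvdnP[m ->] : (q %| 'C(q, i))%N.
  by apply: prime_dvd_bin; rewrite // lt0n i_neq0 ltn_neqAle i_neqq -ltnS /=.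
rewrite -mulr_natr natrM.
transitivity (1 ^+ (q - i) * y ^+ i * m%:R * (q%:R * e)); first by ring.
by have /eqP-> : q%:R * e == 0; rewrite ?dvd_e ?mulr0.
Qed.

Lemma idem_frobenius_iter j : e * (1 + x) ^+ (q ^ j) = e * (1 + x ^+ (q ^ j)).
Proof.
elim: j => [|j IH]; first by rewrite !expr1.
by rewrite !expnSr !exprM (idem_exp q IH) idem_frobenius.
Qed.

(** The powers of the Frobenius map are ring endomorphisms of [e S], to which
    [no_negation] applies. *)
Lemma frobenius_neq_opp j : x ^+ (q ^ j) <> - x.
Proof.
move=> xj; have [i iE] := unit_1Dx; apply: (no_negation iE).
by rewrite -xj -idem_frobenius_iter (idem_exp _ iE) exprAC.
Qed.

Lemma natr_unit m : coprime m q -> exists i, e * m%:R = e * x ^+ i.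
Proof.
move=> co_mq; have [w wE] := coprime_inv_mod co_mq (prime_gt0 q_pr).
apply: (@lift_unit _ w%:R); rewrite -mulrA -natrM mulrC.
apply/eqP; rewrite -subr_eq0 -{2}[e]mul1r -mulrBl -[1]/(1%:R) -natrB ?dvd_e.
  by rewrite -eqn_mod_dvd ?wE //; case: (_ * _)%N wE; rewrite // mod0n modn_small ?prime_gt1.
by case: (_ * _)%N wE; rewrite // mod0n modn_small ?prime_gt1.
Qed.

Lemma natr_idem_inj m1 m2 : e * m1%:R = e * m2%:R -> m1 = m2 %[mod q].
Proof.
wlog le12 : m1 m2 / (m1 <= m2)%N.
  by move=> IH; case/orP: (leq_total m1 m2) => le; [|move/esym]; move/(IH _ _ le).
move/eqP; rewrite eq_sym -subr_eq0 -mulrBr -natrB // mulrC dvd_e -eqn_mod_dvd //.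
by move/eqP.
Qed.

(** The component of [x] in [e S] has the same order as [x], because
    [e x + (1 - e)] to the power [2 ^ (k - 1)] is [1 - 2 e = -1]. *)
Lemma idem_order m1 m2 : e * x ^+ m1 = e * x ^+ m2 -> m1 = m2 %[mod 2 ^ k].
Proof.
pose y := e * x + (1 - e) => eqm.
have yE m : y ^+ m = e * x ^+ m + (1 - e).
  elim: m => [|m IH]; first by rewrite expr0 mulr1 addrC subrK.
  rewrite exprSr IH [x ^+ m.+1]exprSr /y.
  transitivity (e * e * x ^+ m * x + (1 - e) + (e - e * e) * (x ^+ m + x - 1)); first by ring.
  by rewrite ee subrr mul0r addr0 mulrA.
have pry : (2 ^ k).-primitive_root y.
  apply: prim_root_pow2 => //.
    by rewrite yE (prim_expr_order prx) mulr1 addrC subrK.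
  rewrite yE expr_half_order; have -> : e * -1 + (1 - e) = 1 - 2%:R * e by ring.
  by rewrite e2 -subr_eq0 addrC addKr oppr_eq0 two_neq0.
by apply/eqP; rewrite -(eq_prim_root_expr pry) !yE eqm.
Qed.

(** By [frobenius_neq_opp] no power of [q] is [1 + 2 ^ (k - 1)] modulo [2 ^ k], so
    [2 ^ k] divides [q ^ 2 - 1], and even [q - 1] if [q] is 1 modulo 4. On the
    other hand, the [q - 1] units of the prime field of [e S] are powers of [x].
    If [q] is 1 modulo 4, then they are as many as the powers of [x], so [x] is
    one of them. If [q] is 3 modulo 4, then 2 has 2-power order modulo [q], so
    [q = 3], and [2 ^ k] divides [3 ^ 2 - 1]. *)
Lemma odd_component_cases :
  (q = (2 ^ k).+1 /\ exists m, e * x = e * m%:R) \/ (k = 3 /\ q = 3)%N.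
Proof.
have q_gt1 := prime_gt1 q_pr.
have [dvd2 dvd1] : (2 ^ k %| q ^ 2 - 1)%N /\ (q = 1 %[mod 4] -> 2 ^ k %| q - 1)%N.
  apply: pow2_dvd_sqrm1 => // j qj; apply: (@frobenius_neq_opp j).
  have /eqP-> : x ^+ (q ^ j) == x ^+ (1 + 2 ^ k.-1) by rewrite (eq_prim_root_expr prx) qj.
  by rewrite exprD expr1 expr_half_order mulrN1.
have coq (c : 'I_q.-1) : coprime c.+1 q.
  rewrite coprime_sym prime_coprime // gtnNdvd //.
  by rewrite -[X in (_ < X)%N]prednK ?prime_gt0 // ltnS.
have [g gE] : exists g : 'I_q.-1 -> nat, forall c : 'I_q.-1, e * c.+1%:R = e * x ^+ g c.
  have gex (c : 'I_q.-1) : exists i, e * c.+1%:R = e * x ^+ i by apply: natr_unit.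
  exact: fin_all_exists gex.
have pow_gt0 : (0 < 2 ^ k)%N by rewrite expn_gt0.
pose h (c : 'I_q.-1) : 'I_(2 ^ k) := Ordinal (ltn_pmod (g c) pow_gt0).
have hE c : x ^+ h c = x ^+ g c.
  by apply/eqP; rewrite (eq_prim_root_expr prx) modn_mod.
have inj_h : injective h.
  move=> c c' hcc'; apply: val_inj.
  have /natr_idem_inj : e * c.+1%:R = e * c'.+1%:R by rewrite !gE -!hE hcc'.
  rewrite !modn_small; first by case.
    by rewrite -[X in (_ < X)%N]prednK ?prime_gt0 // ltnS.
  by rewrite -[X in (_ < X)%N]prednK ?prime_gt0 // ltnS.
have le_q : (q.-1 <= 2 ^ k)%N by have := leq_card h inj_h; rewrite !card_ord.
have [q1|q3] : q = 1 %[mod 4] \/ q = 3 %[mod 4].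
- have : odd (q %% 4) by rewrite odd_mod.
  have : (q %% 4 < 4)%N by rewrite ltn_mod.
  by case: (q %% 4)%N => [|[|[|[|]]]] //; [left|right].
- left; have qE : q.-1 = (2 ^ k)%N.
    apply/eqP; rewrite eqn_leq le_q dvdn_leq // -?subn1 ?dvd1 // subn_gt0 //.
  split; first by rewrite -qE prednK ?prime_gt0.
  have one_lt : (1 < 2 ^ k)%N by rewrite -[1%N]/(2 ^ 0)%N ltn_exp2l.
  have /codomP[c cE] : Ordinal one_lt \in codom h.
    by apply: inj_card_onto; rewrite // !card_ord qE.
  by exists (c.+1); rewrite gE -hE -cE.
right; have q_eq3 : q = 3.
  apply: (@eq3_of_pow2_order k) => //.
  have [|i iE] := @natr_unit 2; first by rewrite coprime2n.
  rewrite -dvd_e natrB ?expn_gt0 // mulrBl mul1r mulrC natrX (idem_exp _ iE).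
  by rewrite -exprM mulnC exprM (prim_expr_order prx) expr1n mulr1 subrr.
split=> //; move: dvd2; rewrite q_eq3 -[(3 ^ 2 - 1)%N]/(2 ^ 3)%N dvdn_Pexp2l // => k_le.
by apply/eqP; rewrite eqn_leq k_le.
Qed.

End CyclicUnits.

(** * The subring generated by one element *)
Section GeneratedSubring.

Local Open Scope quotient_scope.

Variables (R : nzRingType) (X : R).

Let comm_int : commr_rmorph (intmul (1 : R)) X.
Proof. by move=> m; apply: commr_int. Qed.

Definition int_eval : {poly int} -> R := horner_morph comm_int.
HB.instance Definition _ := GRing.RMorphism.on int_eval.

Definition int_eval_kernel : pred {poly int} := fun p => int_eval p == 0.

Fact int_eval_kernel_closed : idealr_closed int_eval_kernel.
Proof.
split=> [||a p r]; rewrite !unfold_in ?rmorph0 ?rmorph1 ?oner_neq0 //.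
by move=> /eqP p0 /eqP r0; apply/eqP; rewrite rmorphD rmorphM /= p0 r0 mulr0 addr0.
Qed.
HB.instance Definition _ :=
  isIdealr.Build {poly int} int_eval_kernel int_eval_kernel_closed.

(** Writing Z[X] as a quotient of the polynomial ring gives it the structure of a
    commutative ring, which a subset of [R] would not inherit. *)
Definition int_adjoin := Quotient.quot (Idealr.clone {poly int} int_eval_kernel _).
HB.instance Definition _ := GRing.ComNzRing.on int_adjoin.

Definition int_adjoin_val (s : int_adjoin) : R := int_eval (generic_quotient.repr s).

Lemma int_adjoin_val_pi p : int_adjoin_val (\pi_int_adjoin p) = int_eval p.
Proof.
apply/eqP; rewrite -subr_eq0 -rmorphB; change (generic_quotient.repr (\pi_int_adjoin p) - p \in int_eval_kernel).
by rewrite Quotient.idealrBE reprK.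
Qed.

Fact int_adjoin_val_zmod : zmod_morphism int_adjoin_val.
Proof.
move=> s t; rewrite -[s]reprK -[t]reprK -rmorphB !int_adjoin_val_pi.
by rewrite rmorphB.
Qed.
HB.instance Definition _ :=
  GRing.isZmodMorphism.Build int_adjoin R int_adjoin_val int_adjoin_val_zmod.

Fact int_adjoin_val_monoid : monoid_morphism int_adjoin_val.
Proof.
split=> [|s t]; first by rewrite -(rmorph1 (\pi_int_adjoin)) int_adjoin_val_pi rmorph1.
by rewrite -[s]reprK -[t]reprK -rmorphM !int_adjoin_val_pi rmorphM.
Qed.
HB.instance Definition _ :=
  GRing.isMonoidMorphism.Build int_adjoin R int_adjoin_val int_adjoin_val_monoid.

Lemma int_adjoin_val_inj : injective int_adjoin_val.
Proof.
move=> s t st; rewrite -[s]reprK -[t]reprK; apply/eqP.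
rewrite -Quotient.idealrBE unfold_in; apply/eqP.
by rewrite rmorphB; apply/eqP; rewrite subr_eq0; apply/eqP.
Qed.

Definition int_adjoin_gen : int_adjoin := \pi_int_adjoin 'X.

Lemma int_adjoin_genE : int_adjoin_val int_adjoin_gen = X.
Proof. by rewrite int_adjoin_val_pi; apply: horner_morphX. Qed.

Lemma int_adjoin_unit s t : s * t = 1 ->
  int_adjoin_val s * int_adjoin_val t = 1 /\ int_adjoin_val t * int_adjoin_val s = 1.
Proof. by move=> st; rewrite -!rmorphM [t * s]mulrC st rmorph1. Qed.

End GeneratedSubring.

(** * Elements of order a power of 2 that generate their own centralizer *)
Section SelfCentralizing.

Variables (R : nzRingType) (X : R) (k : nat).
Hypotheses (k_gt2 : (2 < k)%N) (prX : (2 ^ k).-primitive_root X).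
Hypothesis unit_X : forall u v : R, u * v = 1 -> v * u = 1 -> u * X = X * u ->
  exists i, u = X ^+ i.

(* [S] plays the role of Z[X]. *)
Variables (S : comNzRingType) (val : {rmorphism S -> R}) (x : S).
Hypotheses (val_inj : injective val) (val_x : val x = X).

Let valX i : val (x ^+ i) = X ^+ i.
Proof. by rewrite rmorphXn val_x. Qed.

Lemma prim_root_gen : (2 ^ k).-primitive_root x.
Proof.
have x1 i : (x ^+ i == 1) = (X ^+ i == 1).
  by rewrite -(inj_eq val_inj) rmorph1 valX.
apply: prim_root_pow2; first exact: leq_trans k_gt2.
  by apply/eqP; rewrite x1 (prim_expr_order prX).
by rewrite x1 -(prim_order_dvd prX) dvdn_Pexp2l // -ltnNge prednK // (leq_trans _ k_gt2).
Qed.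

(** The units of Z[X] commute with [X]; so Z[X] is one of the commutative rings
    studied above. *)
Lemma gen_unit (u v : S) : u * v = 1 -> exists i, u = x ^+ i.
Proof.
move=> uv; have [|||i uE] := @unit_X (val u) (val v).
- by rewrite -rmorphM uv rmorph1.
- by rewrite -rmorphM mulrC uv rmorph1.
- by rewrite -val_x -!rmorphM mulrC.
by exists i; apply: val_inj; rewrite uE valX.
Qed.

Lemma fermat_or_eq3 : k = 3%N \/ prime (2 ^ k).+1.
Proof.
have [q [c [q_pr odd_q cc c2 dvd_c]]] := odd_component k_gt2 prim_root_gen gen_unit.
have [[qE _]|[k3 _]] := odd_component_cases k_gt2 prim_root_gen gen_unit q_pr odd_q cc c2 dvd_c.
  by right; rewrite -qE.
by left.
Qed.

Lemma exp_conj (Z : R) r i : Z * X = X ^+ r * Z -> Z * X ^+ i = X ^+ (r * i) * Z.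
Proof.
move=> ZX; elim: i => [|i IH]; first by rewrite muln0 mulr1 mul1r.
by rewrite exprSr mulrA IH -mulrA ZX mulrA -exprD mulnS addnC.
Qed.

(** Let [E] be the idempotent given by [odd_component]. If [q = 2 ^ k + 1], then
    [E X] is an integer multiple of [E], hence central, and conjugation by [Y]
    fixes [X] because [X] and [E X] have the same order.

    Otherwise [q = 3] and [X] has order 8, so [r] is 1, 3, 5 or 7 modulo 8. For
    [r = 5], conjugation by [Y] maps [X] to [X ^ 5 = - X], which contradicts
    [no_negation]. So does, for [r = 7], its composite with the Frobenius map
    [X |-> X ^ 3], because 21 is 5 modulo 8. For [r = 3], one of [Y] and [X Y] is
    an involution [Z] that induces the same automorphism. The element
    [a = E (1 + Z) X (1 - Z)] has square 0, and [3 a = 0], so the order of the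
    unit [1 + a] divides 3; being a power of 2, it is 1. As
    [a = E (X - X ^ 3) (1 - Z)] and [X - X ^ 3] divides 2, it follows that
    [E Z = E]. But then [E X = E X ^ 3], whereas [X] and [E X] have the same
    order. *)
Lemma not_normalized (Y Y' : R) r j N :
    Y * Y' = 1 -> Y' * Y = 1 -> Y * Y = X ^+ j -> Y * X = X ^+ r * Y ->
    (forall u v : R, u * v = 1 -> v * u = 1 -> u ^+ (2 ^ N) = 1) ->
  r = 1 %[mod 2 ^ k].
Proof.
move=> YY' Y'Y Y2 YX unit_pow2.
have cancelY a b : a * Y = b * Y -> a = b.
  by move=> /(congr1 (fun t => t * Y')); rewrite -!mulrA YY' !mulr1.
have [q [c [q_pr odd_q ee e2 dvd_e]]] := odd_component k_gt2 prim_root_gen gen_unit.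
set e : S := c%:R in ee e2 dvd_e; pose E : R := c%:R.
have valE : val e = E by rewrite rmorph_nat.
have commE a : a * E = E * a by apply: commr_nat.
have central m : E * X ^+ m = E * X -> m = 1 %[mod 2 ^ k].
  move=> eqX; apply: (idem_order k_gt2 prim_root_gen gen_unit ee e2).
  by apply: val_inj; rewrite !rmorphM valE !valX expr1.
have [[_ [m xE]]|[k3 q3]] :=
    odd_component_cases k_gt2 prim_root_gen gen_unit q_pr odd_q ee e2 dvd_e.
  have EX : E * X = E * m%:R.
    by have := congr1 val xE; rewrite !rmorphM valE val_x rmorph_nat.
  apply: central; apply: cancelY.
  have EXY : Y * (E * X) = E * X * Y by rewrite EX -natrM; apply: commr_nat.
  by rewrite -EXY mulrA commE -[RHS]mulrA YX mulrA.
have E3 : 3%:R * E = 0.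
  by have /eqP := dvd_e 3; rewrite q3 dvdnn -valE => /(congr1 val); rewrite rmorphM rmorph_nat rmorph0.
have k8 : (2 ^ k = 8)%N by rewrite k3.
have X4 : X ^+ 4 = -1.
  have := congr1 val (expr_half_order k_gt2 prim_root_gen gen_unit).
  by rewrite k3 valX rmorphN1.
have [i eiE] := unit_1Dx k_gt2 prim_root_gen gen_unit odd_q ee dvd_e.
have EiE : E * (1 + X) = E * X ^+ i.
  by have := congr1 val eiE; rewrite !rmorphM rmorphD rmorph1 valE val_x valX.
have no_neg : E * (1 - X) <> E * (- X) ^+ i.
  move=> niE; apply: (no_negation k_gt2 prim_root_gen gen_unit e2 eiE); apply: val_inj.
  by rewrite !rmorphM rmorphB rmorph1 rmorphXn rmorphN valE val_x niE.
have expX m1 m2 : m1 = m2 %[mod 8] -> X ^+ m1 = X ^+ m2.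
  by move=> m12; apply/eqP; rewrite (eq_prim_root_expr prX) k8 m12.
have X5 : X ^+ 5 = - X by rewrite exprS X4 mulrN1.
have odd_r : odd r.
  have : X ^+ (r * r) = X ^+ 1.
    apply: (cancelY _ _); apply: (cancelY _ _); rewrite -(exp_conj r YX) -[LHS]mulrA -YX.
    by rewrite mulrA Y2 -[RHS]mulrA Y2 -exprSr -exprD add1n.
  move/eqP; rewrite (eq_prim_root_expr prX) k8 => /eqP/(congr1 odd).
  by rewrite !odd_mod // oddM andbb.
have r_cases : r = 1 %[mod 8] \/ r = 3 %[mod 8] \/ r = 5 %[mod 8] \/ r = 7 %[mod 8].
  have : odd (r %% 8) by rewrite odd_mod.
  have : (r %% 8 < 8)%N by rewrite ltn_mod.
  by case: (r %% 8)%N => [|[|[|[|[|[|[|[|]]]]]]]] //; tauto.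
have conj m t : E * (1 + X ^+ m) = E * X ^+ t -> E * (1 + X ^+ (r * m)) = E * X ^+ (r * t).
  move=> Emt; apply: cancelY; rewrite -!mulrA -(exp_conj t YX).
  have -> : (1 + X ^+ (r * m)) * Y = Y * (1 + X ^+ m).
    by rewrite mulrDl mulrDr mul1r mulr1 (exp_conj m YX).
  by rewrite mulrA -commE -mulrA Emt mulrA commE -mulrA.
rewrite k8; case: r_cases => [//|[r3|[r5|r7]]]; exfalso.
- have YX3 : Y * X = X ^+ 3 * Y by rewrite YX (expX _ _ r3).
  have [Z [Z2 ZX]] : exists Z, Z * Z = 1 /\ Z * X = X ^+ 3 * Z.
    have /eqP : X ^+ (3 * j) = X ^+ j.
      by apply: cancelY; rewrite -exp_conj // -Y2 mulrA.
    rewrite (eq_prim_root_expr prX) k8 => /eqP j3.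
    have [j0|j4] : j = 0 %[mod 8] \/ j = 4 %[mod 8] by lia.
      by exists Y; rewrite Y2 (expX _ _ j0).
    exists (X * Y); split; last first.
      by rewrite -mulrA YX3 [LHS]mulrA [RHS]mulrA -exprS -exprSr.
    rewrite -mulrA [Y * _]mulrA YX3 -[X ^+ 3 * Y * Y]mulrA Y2 (expX _ _ j4).
    by rewrite [LHS]mulrA -exprS X4 mulrNN mulr1.
  have Z0 : (1 - Z) * (1 + Z) = 0.
    by rewrite mulrDr mulr1 mulrBl mul1r Z2 addrA subrK subrr.
  pose a := E * ((1 + Z) * X * (1 - Z)).
  have aE : a = E * ((X - X ^+ 3) * (1 - Z)).
    have Z1 : Z * (1 - Z) = - (1 - Z) by rewrite mulrBr mulr1 Z2 opprB.
    rewrite /a [(1 + Z) * X]mulrDl mul1r ZX mulrDl -[X ^+ 3 * Z * _]mulrA Z1.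
    by rewrite mulrN -mulrBl.
  have aa : a * a = 0.
    suff EB B : B * B = 0 -> E * B * (E * B) = 0.
      by apply: EB; rewrite -!mulrA [(1 - Z) * ((1 + Z) * _)]mulrA Z0 mul0r !mulr0.
    by move=> BB; rewrite mulrA commE -!mulrA BB !mulr0.
  have a3 : 3%:R * a = 0 by rewrite /a mulrA E3 mul0r.
  have a0 : a = 0.
    have u2 : (1 + a) ^+ (2 ^ N) = 1.
      apply: (unit_pow2 _ (1 - a)).
        by rewrite mulrDl mul1r mulrBr mulr1 aa subr0 subrK.
      by rewrite mulrBl mul1r mulrDr mulr1 aa addr0 addrK.
    apply: (@coprime_natr_torsion _ _ 3 (2 ^ N)) => //; first by rewrite coprimeXr.
    by move/eqP: u2; rewrite exp_1D_square0 // -subr_eq0 addrC addKr => /eqP.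
  have EZ : E * Z = E.
    have : (E * (1 - Z)) = 0.
      have t2 : 2%:R * (E * (1 - Z)) = 0.
        (* As [X ^ 8 = 1], this is [(1 + X ^ 2) (1 - X ^ 2) = 1 - X ^ 4]. *)
        have -> : 2%:R = (1 + X ^+ 2) * X ^+ 7 * (X - X ^+ 3) :> R.
          rewrite -mulrA mulrBr -exprSr -exprD (expX 8%N 0%N erefl) (expX 10%N 2%N erefl).
          by rewrite expr0 mulrDl mul1r mulrBr mulr1 -exprD addrA subrK X4 opprK.
        by rewrite -mulrA [(X - _) * (E * _)]mulrA commE -[E * _ * _]mulrA -aE a0 mulr0.
      apply: (@coprime_natr_torsion _ _ 3 2) => //.
      by rewrite mulrA E3 mul0r.
    by rewrite mulrBr mulr1 => /eqP; rewrite subr_eq0 => /eqP.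
  suff /central : E * X ^+ 3 = E * X by rewrite k8.
  by rewrite -{2}EZ -mulrA ZX mulrA -commE -[RHS]mulrA EZ commE.
- apply: no_neg; have := conj 1%N i; rewrite !expr1 muln1 => /(_ EiE).
  by rewrite exprM (expX _ _ r5) X5.
have E3i : E * (1 + X ^+ 3) = E * X ^+ (i * 3).
  have := idem_frobenius q_pr dvd_e x; rewrite q3 => /esym.
  rewrite (idem_exp ee _ eiE) -exprM => /(congr1 val).
  by rewrite !rmorphM rmorphD rmorph1 valE !valX.
apply: no_neg; have := conj _ _ E3i.
rewrite (_ : r * (i * 3) = r * 3 * i)%N ?[X ^+ (r * 3 * i)]exprM; last by lia.
have -> : X ^+ (r * 3) = - X; last by [].
by rewrite -X5; apply: expX; rewrite -modnMml r7.
Qed.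

End SelfCentralizing.

(** * Rings of characteristic 2 whose units form a group of odd order *)

(** If [j] is odd, then [p ^ j + 1 = (p + 1) c] with [c] odd, so that [c = 1]. If
    [j] is even, then [p ^ j + 1] is 2 modulo 4, and larger than 2. *)
Lemma prime_power_pred_pow2 p d j : prime p -> odd p -> (0 < j)%N ->
  (2 ^ d - 1 = p ^ j)%N -> j = 1%N.
Proof.
move=> p_pr odd_p j_gt0 dj; have p_gt1 := prime_gt1 p_pr.
have pjE : (2 ^ d = (p ^ j).+1)%N by rewrite -dj subn1 prednK ?expn_gt0.
have [j_lt2|j_gt1] := ltnP j 2; first by apply/eqP; rewrite eqn_leq j_gt0 -ltnS j_lt2.
have p2_mod4 : (p ^ 2 = 1 %[mod 4])%N.
  by rewrite -modnXm; have : odd (p %% 4) by [rewrite odd_mod]; have := ltn_pmod p (isT : 0 < 4)%N;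
     case: (p %% 4)%N => [|[|[|[|]]]].
have [odd_j|even_j] := boolP (odd j).
  have [c odd_c cE] : exists2 c, odd c & ((p ^ j).+1 = p.+1 * c)%N.
    rewrite -[j]odd_double_half odd_j; elim: j./2 => [|i [c odd_c cE]].
      by exists 1%N; rewrite // muln1 expn1.
    have c_gt0 : (0 < c)%N by case: c odd_c {cE}.
    exists (p ^ 2 * c - (p - 1))%N.
      rewrite oddB; last by rewrite expnS expn1 -mulnA (leq_trans (leq_subr 1 p)) // leq_pmulr // muln_gt0 c_gt0 ltnW.
      by rewrite oddM oddX odd_p odd_c oddB ?odd_p // ltnW.
    have -> : (true + i.+1.*2 = 2 + (true + i.*2))%N by rewrite doubleS /= !addnS.
    have sqr_pred : (p.+1 * (p - 1) = p ^ 2 - 1)%N by rewrite -[1%N in RHS](exp1n 2) subn_sqr addn1 mulnC.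
    rewrite expnD mulnBr sqr_pred mulnCA -cE mulnS.
    have cancel A D : (0 < A)%N -> (D.+1 = A + D - (A - 1))%N by lia.
    by apply: cancel; rewrite expn_gt0 ltnW.
  have : (c %| 2 ^ d)%N by rewrite pjE cE dvdn_mull.
  case/(dvdn_pfactor _ _ (isT : prime 2)) => [[|m] _ c1]; last first.
    by move: odd_c; rewrite c1 oddX.
  have : (p ^ j <= p ^ 1)%N by rewrite -ltnS cE c1 muln1 expn1.
  by rewrite leq_exp2l // leqNgt j_gt1.
have pj1 : (p ^ j = 1 %[mod 4])%N.
  by rewrite -[j]even_halfK // -mul2n expnM -modnXm p2_mod4 modnXm exp1n.
have : (2 ^ d = 2 %[mod 4])%N by rewrite pjE -addn1 -modnDml pj1.
case: d {dj} pjE => [|[|d]] pjE.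
- by [].
- have : (p ^ 0 < p ^ j)%N by rewrite ltn_exp2l.
  by case: pjE => <-.
by rewrite !expnS mulnA modnMr.
Qed.

Section OddUnits.

Variables (S : comNzRingType) (p k N : nat) (x : S).
Hypotheses (p_pr : prime p) (odd_p : odd p) (k_gt0 : (0 < k)%N).
Hypotheses (charS : 2 \in [pchar S]).
Hypotheses (x_pow : x ^+ (p ^ k) = 1) (x_prim : x ^+ (p ^ k.-1) != 1).
Hypothesis unit_pow : forall u v : S, u * v = 1 -> u ^+ (p ^ N) = 1.

Let A := pPrimeCharType charS.
Let ev : {rmorphism {poly 'F_2} -> A} := horner_alg (x : A).
Let evX : ev 'X = x. Proof. exact: horner_algX. Qed.

(** In characteristic 2 the square of [1 + b] is 1, but its order is odd. *)
Lemma square0_eq0 (b : S) : b * b = 0 -> b = 0.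
Proof.
move=> bb; have : (1 + b) ^+ (p ^ N) = 1.
  by apply: (unit_pow (v := 1 - b)); transitivity (1 - b * b); [ring | rewrite bb subr0].
rewrite exp_1D_square0 // -[(p ^ N)%N]odd_double_half oddX odd_p orbT natrD -mul2n natrM.
rewrite (pcharf0 charS) mul0r addr0 mul1r => /eqP.
by rewrite -subr_eq0 addrC addKr => /eqP.
Qed.

(** A polynomial of least degree among the nonconstant ones that annihilate some
    nonzero multiple of [b0] is irreducible; [X ^ (p ^ k) - 1] is one that
    annihilates all of them. *)
Lemma irreducible_annihilator (b0 : A) : b0 != 0 ->
  exists (q : {poly 'F_2}) (s : A),
    [/\ irreducible_poly q, b0 * s != 0 & ev q * (b0 * s) = 0].
Proof.
move=> b0_neq0.
suff ind n (q : {poly 'F_2}) s : (1 < size q <= n)%N -> b0 * s != 0 -> ev q * (b0 * s) = 0 ->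
    exists (q : {poly 'F_2}) (s : A),
    [/\ irreducible_poly q, b0 * s != 0 & ev q * (b0 * s) = 0].
  apply: (ind (p ^ k).+1 ('X^(p ^ k) - 1) 1); rewrite ?mulr1 ?size_XnsubC ?leqnn ?ltnS ?expn_gt0 ?prime_gt0 //.
  by rewrite rmorphB rmorph1 rmorphXn /= evX x_pow subrr mul0r.
elim: n q s => [|n IH] q s /andP[q_gt1]; first by rewrite leqNgt (ltnW q_gt1).
move=> q_le s_neq0 qs0; have [irr_q|] := boolP (irreducibleb q).
  by exists q, s; split=> //; apply/irreducibleP.
rewrite /irreducibleb q_gt1 /= => /forallPn[q1].
rewrite -Pdiv.Idomain.dvdpE negb_imply -ltnNge => /andP[/dvdpP[q2 qE] q1_gt1].
have q_neq0 : q != 0 by rewrite -size_poly_gt0 ltnW.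
have q1_lt : (size (q1 : {poly _}) < size q)%N.
  by rewrite -[X in (_ < X)%N]prednK ?ltnS ?size_npoly // ltnW.
have [qs1|qs1] := eqVneq (b0 * (ev q1 * s)) 0.
  apply: (IH q1 s) => //; last by rewrite mulrCA.
  by rewrite q1_gt1 -ltnS (leq_trans q1_lt).
apply: (IH q2 (ev q1 * s)) => //; last first.
  by rewrite [b0 * (_ * _)]mulrCA [LHS]mulrA -rmorphM -qE.
have q2_neq0 : q2 != 0 by apply: contraNneq q_neq0; rewrite qE => ->; rewrite mul0r.
have q1_neq0 : (q1 : {poly _}) != 0 by rewrite -size_poly_gt0 ltnW.
have sizeE : size q = (size q2 + size (q1 : {poly _})).-1 by rewrite -size_mul // -[in RHS]qE.
have nat_aux a b t m : t = (a + b).-1 -> (t <= m.+1)%N -> (1 < b)%N -> (b < t)%N ->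
  (1 < a <= m)%N by lia.
exact: nat_aux sizeE q_le q1_gt1 q1_lt.
Qed.

(** Let [q] be irreducible and annihilate a nonzero multiple of
    [x ^ (p ^ (k - 1)) - 1]. It divides [X ^ (p ^ k) - 1], but not
    [X ^ (p ^ (k - 1)) - 1], since [S] has no nonzero nilpotent elements. So the
    class of [X] has order [p ^ k] in the field [L = F_2[X] / q]. As
    [X ^ (p ^ k) - 1] is separable, [L] is a direct factor of
    [F_2[X] / (X ^ (p ^ k) - 1)], and its units lift to units of this ring, which
    map to units of [S]. Hence they have [p]-power order, and their number
    [2 ^ d - 1] is a power [p ^ j] with [j >= k]. *)
Lemma odd_units : k = 1%N /\ exists d, p = (2 ^ d - 1)%N.
Proof.
have n_gt0 : (0 < p ^ k)%N by rewrite expn_gt0 prime_gt0.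
pose b0 : A := x ^+ (p ^ k.-1) - 1.
have b0_neq0 : b0 != 0 by rewrite subr_eq0.
have [q' [s [irr_q' s_neq0 qs0']]] := irreducible_annihilator b0_neq0.
have [q [irr_q q_monic qs0]] : exists q : {poly 'F_2},
    [/\ irreducible_poly q, q \is monic & ev q * (b0 * s) = 0].
  have q'_neq0 : q' != 0 by have [q_gt1 _] := irr_q'; rewrite -size_poly_gt0 ltnW.
  exists q'; split=> //; rewrite monicE; move: q'_neq0; rewrite -lead_coef_eq0.
  by move: (lead_coef q'); case=> [[|[|]]].
have q_dvd w : ev w * (b0 * s) = 0 -> q %| w.
  move=> w0; apply: contraNT s_neq0; rewrite -irreducible_poly_coprime //.
  move/Bezout_eq1_coprimepP => [[u v] /= uv1].
  rewrite -[b0 * s]mul1r -(rmorph1 ev) -uv1 rmorphD !rmorphM mulrDl -!mulrA qs0 w0.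
  by rewrite !mulr0 addr0.
have q_neq0 : q != 0 by apply: monic_neq0.
pose Xn1 : {poly 'F_2} := 'X^(p ^ k) - 1.
have evXn m : ev ('X^m - 1) = x ^+ m - 1 by rewrite rmorphB rmorph1 rmorphXn /= evX.
have ev0 : ev Xn1 = 0 by rewrite evXn x_pow subrr.
have q_ndvd : ~~ (q %| 'X^(p ^ k.-1) - 1).
  apply: contra s_neq0 => /dvdpP[w wE]; apply/eqP; apply: square0_eq0.
  have b0E : b0 = ev w * ev q by rewrite -rmorphM -wE evXn.
  suff : ev w * ev q * s * (b0 * s) = 0 by rewrite -b0E.
  by rewrite -!mulrA [s * (b0 * s)]mulrC [ev q * _]mulrA qs0 mul0r mulr0.
have /dvdpP[c cE] : q %| Xn1 by apply: q_dvd; rewrite ev0 mul0r.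
have co_cq : coprimep c q.
  have : separable_poly Xn1.
    apply: separable_Xn_sub_1; rewrite natrX expf_neq0 // -(dvdn_pcharf (pchar_Fp (isT : prime 2))).
    by rewrite dvdn2 negbK.
  by rewrite cE separable_mul => /and3P[].
have exp_mod w : ~~ (q %| w) -> q %| w ^+ (p ^ N) - 1.
  move=> w_ndvd; have co_qw : coprimep q w by rewrite irreducible_poly_coprime.
  have /Bezout_eq1_coprimepP[[u v] /= uv1] := co_cq.
  (* The lift of [w] that is congruent to [w] modulo [q] and to 1 modulo [c]. *)
  pose w' := w * (u * c) + v * q.
  have w'q : w' = w + q * (v * (1 - w)).
    transitivity (w * (u * c + v * q) + q * (v * (1 - w))); first by rewrite /w'; ring.
    by rewrite uv1 mulr1.
  have w'c : w' = 1 + c * (u * (w - 1)).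
    transitivity ((u * c + v * q) + c * (u * (w - 1))); first by rewrite /w'; ring.
    by rewrite uv1.
  have : coprimep w' Xn1.
    rewrite cE coprimepMr; apply/andP; split.
      by apply/Bezout_eq1_coprimepP; exists (1, - (u * (w - 1))); rewrite w'c /=; ring.
    have /Bezout_eq1_coprimepP[[u0 v0] /= uv0] := co_qw.
    apply/Bezout_eq1_coprimepP; exists (v0, u0 - v0 * (v * (1 - w))); rewrite w'q -uv0 /=.
    by ring.
  case/Bezout_eq1_coprimepP=> [[a a'] /= aE].
  have /unit_pow w'1 : ev w' * ev a = 1 :> S.
    by rewrite mulrC -rmorphM -(rmorph1 ev) -aE rmorphD [ev (a' * _)]rmorphM ev0 mulr0 addr0.
  have : q %| w' ^+ (p ^ N) - 1.
    by apply: q_dvd; rewrite rmorphB rmorph1 rmorphXn /= w'1 subrr mul0r.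
  have /dvdpP[y yE] : q %| w ^+ (p ^ N) - w' ^+ (p ^ N).
    by rewrite subrXX dvdp_mulr // w'q opprD addNKr dvdpNr dvdp_mulr.
  by move=> q_dvd'; rewrite -(subrK (w' ^+ (p ^ N)) (w ^+ _)) -addrA dvdp_add // yE dvdp_mull.
pose qI : monic_irreducible_poly q := (irr_q, q_monic).
pose L : finFieldType := {poly %/ q with qI}.
have in_qpoly_eq0 (w : {poly 'F_2}) : (in_qpoly q w == 0) = (q %| w).
  by rewrite Pdiv.Idomain.dvdpE /Pdiv.Ring.rdvdp -[X in Pdiv.Ring.rmodp w X](mk_monicE qI) -val_eqE.
have L_pow (t : L) : t != 0 -> t ^+ (p ^ N) = 1.
  move=> t_neq0; pose w : {poly 'F_2} := val t.
  have tE : t = in_qpoly q w.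
    by apply/esym/val_inj/in_qpoly_small; apply: size_mk_monic.
  have w_ndvd : ~~ (q %| w) by rewrite -in_qpoly_eq0 -tE.
  apply/eqP; rewrite -subr_eq0 tE -(rmorphXn (in_qpoly q)) -(rmorph1 (in_qpoly q)) -rmorphB.
  by rewrite in_qpoly_eq0 exp_mod.
have pG : (p.-group [set: {unit L}])%g.
  apply/pgroupP => // r r_pr r_dvd; have [u _ ou] := Cauchy r_pr r_dvd.
  have : (r %| p ^ N)%N.
    rewrite -ou order_dvdn; apply/eqP/val_inj; rewrite FinRing.val_unitX FinRing.val_unit1.
    by apply: L_pow; rewrite -unitfE; apply: (valP u).
  by rewrite Euclid_dvdX // => /andP[r_p _]; rewrite inE -dvdn_prime2.
have [j jE] := p_natP pG.
have cardL : #|L| = (2 ^ (size q).-1)%N by rewrite card_qfpoly card_ord.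
rewrite card_finField_unit cardL -subn1 in jE.
pose z : L := in_qpoly q 'X.
have zX m : (z ^+ m == 1) = (q %| 'X^m - 1).
  rewrite -subr_eq0 -(rmorphXn (in_qpoly q)) -(rmorph1 (in_qpoly q)) -rmorphB.
  exact: in_qpoly_eq0.
have z_neq0 : z != 0.
  have : z ^+ (p ^ k) == 1 by rewrite zX q_dvd // evXn x_pow subrr mul0r.
  by apply: contraTneq => ->; rewrite expr0n eqn0Ngt n_gt0 eq_sym oner_eq0.
have z1 : z ^+ (p ^ j) = 1.
  apply: (mulfI z_neq0); rewrite -exprS -jE mulr1 subn1 prednK ?expn_gt0 //.
  by rewrite -cardL expf_card.
have j_ge : (k <= j)%N.
  rewrite leqNgt; apply: contra q_ndvd => lt_jk; rewrite -zX.
  by rewrite -(subnK (_ : j <= k.-1)%N) ?expnD 1?mulnC ?exprM ?z1 ?expr1n // -ltnS prednK.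
have j_gt0 := leq_trans k_gt0 j_ge.
have j1 := prime_power_pred_pow2 p_pr odd_p j_gt0 jE.
split; last by exists (size q).-1; rewrite jE j1 expn1.
by apply/eqP; rewrite eqn_leq k_gt0 -j1 j_ge.
Qed.

End OddUnits.

(** * Realizable groups *)
Import GroupScope.
Local Open Scope ring_scope.

(** The zero ring realizes only the trivial group. *)
Lemma realizable_nzRing (gT : finGroupType) (G : {group gT}) :
    realizable G -> G :!=: 1%g ->
  exists (R : nzRingType) (f : gT -> R),
    [/\ {in G &, forall x y, f (x * y)%g = f x * f y}, {in G &, injective f},
        forall x, x \in G -> exists v, v * f x = 1 /\ f x * v = 1
      & forall u v : R, u * v = 1 -> v * u = 1 -> exists2 x, x \in G & f x = u].
Proof.
case=> R [f [fM f_inj fU]] ntG.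
have nz1 : (1 : R) != 0.
  apply: contraNneq ntG => one0; apply/eqP/trivgP/subsetP => x Gx; rewrite inE.
  apply/eqP; apply: f_inj => //; rewrite -[f x]mul1r -[f 1%g]mul1r.
  by rewrite one0 !mul0r.
pose nzR := GRing.PzSemiRing_isNonZero.Build R nz1.
pose R' : nzRingType := HB.pack R nzR.
exists R', f; split=> // [x Gx|u v uv vu]; first by apply/fU; exists x.
by apply/fU; exists v.
Qed.

Section Realized.

Variables (gT : finGroupType) (G : {group gT}) (R : nzRingType) (f : gT -> R).
Hypothesis fM : {in G &, forall x y, f (x * y)%g = f x * f y}.
Hypothesis f_inj : {in G &, injective f}.
Hypothesis f_unit : forall x, x \in G -> exists v, v * f x = 1 /\ f x * v = 1.
Hypothesis unit_f : forall u v : R, u * v = 1 -> v * u = 1 -> exists2 x, x \in G & f x = u.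

Lemma f_one : f 1%g = 1.
Proof.
have [v [v1 _]] := f_unit (group1 G).
by rewrite -[f _]mul1r -v1 -mulrA -fM ?group1 // mulg1.
Qed.

Lemma f_exp x i : x \in G -> f (x ^+ i)%g = f x ^+ i.
Proof.
move=> Gx; elim: i => [|i IH]; first by rewrite f_one.
by rewrite expgS fM ?groupX // IH exprS.
Qed.

Lemma f_exp_eq1 x i : x \in G -> (f x ^+ i == 1) = (#[x]%g %| i)%N.
Proof.
by move=> Gx; rewrite -f_exp // -f_one (inj_in_eq f_inj) ?groupX // order_dvdn.
Qed.

Lemma f_prim x k : x \in G -> #[x]%g = (2 ^ k)%N -> (0 < k)%N -> (2 ^ k).-primitive_root (f x).
Proof.
move=> Gx ox k_gt0; apply: prim_root_pow2 => //; first by apply/eqP; rewrite f_exp_eq1 ?ox.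
by rewrite f_exp_eq1 // ox dvdn_Pexp2l // -ltnNge prednK.
Qed.

Lemma unit_order (u v : R) : u * v = 1 -> v * u = 1 -> u ^+ #|G| = 1.
Proof.
move=> uv vu; have [x Gx <-] := unit_f uv vu.
by apply/eqP; rewrite f_exp_eq1 // order_dvdG.
Qed.

Section SelfCentralizingElement.

Variables (x : gT) (k : nat).
Hypotheses (Gx : x \in G) (ox : #[x]%g = (2 ^ k)%N) (k_gt2 : (2 < k)%N).
Hypothesis cent_x : forall g, g \in G -> commute g x -> g \in <[x]>%g.

Lemma unit_commute (u v : R) : u * v = 1 -> v * u = 1 -> u * f x = f x * u ->
  exists i, u = f x ^+ i.
Proof.
move=> uv vu ux; have [g Gg gE] := unit_f uv vu.
have /cycleP[i gxi] : g \in <[x]>%g.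
  by apply: cent_x => //; apply: f_inj; rewrite ?groupM // !fM // gE.
by exists i; rewrite -f_exp // -gxi gE.
Qed.

Let val_inj := @int_adjoin_val_inj R (f x).
Let val_gen := @int_adjoin_genE R (f x).
Let prim_x := f_prim Gx ox (leq_trans (isT : 0 < 3)%N k_gt2).

Lemma self_centralizing_order : k = 3%N \/ prime (2 ^ k).+1.
Proof. exact: (fermat_or_eq3 k_gt2 prim_x unit_commute val_inj val_gen). Qed.

Lemma self_centralizing_normalizer y : (2.-group G)%g ->
  y \in G -> (x ^ y \in <[x]>)%g -> (y ^+ 2 \in <[x]>)%g -> commute y x.
Proof.
move=> /p_natP[N oG] Gy /cycleP[r xyE] y2.
have /cycleP[j y2E] : (y ^- 2 \in <[x]>)%g by rewrite groupV.
have Gy' : (y^-1 \in G)%g by rewrite groupV.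
(* Conjugation is [x ^ y = y^-1 * x * y], so it is [y^-1] that moves past [x]. *)
have YX : f y^-1%g * f x = f x ^+ r * f y^-1%g.
  by rewrite -f_exp // -!fM ?groupX // -xyE conjgE !mulgA mulgK.
have r1 : (r = 1 %[mod 2 ^ k])%N.
  apply: (not_normalized k_gt2 prim_x unit_commute val_inj val_gen
    (Y := f y^-1%g) (Y' := f y) (j := j) (N := N)) => //.
  - by rewrite -fM ?mulVg ?f_one.
  - by rewrite -fM ?mulgV ?f_one.
  - by rewrite -fM // -invMg -f_exp // -y2E expgS expg1.
  - by move=> u v uv vu; rewrite -oG (unit_order uv vu).
apply/commute_sym/commgP/conjg_fixP; rewrite xyE -[RHS]expg1.
by apply/eqP; rewrite eq_expg_mod_order ox r1.
Qed.

End SelfCentralizingElement.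

(** The unit -1 has order at most 2 in a group of odd order, so it is 1, and
    [odd_units] applies to the subring generated by [x]. *)
Lemma odd_realized p x : prime p -> odd p -> (p.-group G)%g -> x \in G -> x != 1%g ->
  #[x]%g = p /\ mersenne_prime p.
Proof.
move=> p_pr odd_p pG Gx x_neq1; have [N oG] := p_natP pG.
have two0 : (2%:R : R) = 0.
  have [g Gg gE] : exists2 g, g \in G & f g = -1.
    by apply: (@unit_f _ (-1)); rewrite mulrNN mulr1.
  have g2 : (#[g]%g %| 2)%N by rewrite -f_exp_eq1 // gE sqrrN expr1n.
  have odd_g : odd #[g]%g by apply: dvdn_odd (order_dvdG Gg) _; rewrite oG oddX odd_p orbT.
  have g1 : g = 1%g.
    by apply/eqP; rewrite -order_eq1 -dvdn1 -(@Gauss_dvdr _ 2) ?coprimen2 // muln1.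
  by rewrite -[2%:R]/(1 + 1 : R) -{1}f_one -g1 gE addNr.
have [k ox] := p_natP (mem_p_elt pG Gx).
have k_gt0 : (0 < k)%N by rewrite lt0n; apply: contraNneq x_neq1 => k0; rewrite -order_eq1 ox k0.
pose S := int_adjoin (f x); pose val : {rmorphism S -> R} := @int_adjoin_val R (f x).
have val_inj : injective val := @int_adjoin_val_inj R (f x).
have val_gen : val (int_adjoin_gen (f x)) = f x := @int_adjoin_genE R (f x).
have charS : 2 \in [pchar S].
  by rewrite inE /=; apply/eqP/val_inj; rewrite rmorph_nat rmorph0.
have gen_exp m : (int_adjoin_gen (f x) ^+ m == 1) = (p ^ k %| m)%N.
  by rewrite -(inj_eq val_inj) rmorphXn rmorph1 /= val_gen f_exp_eq1 // ox.
have [||u v uv|k1 [d pE]] := @odd_units S p k N (int_adjoin_gen (f x)) p_pr odd_p k_gt0 charS.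
- by apply/eqP; rewrite gen_exp.
- by rewrite gen_exp dvdn_Pexp2l ?prime_gt1 // -ltnNge prednK.
- have [uv' vu'] := int_adjoin_unit uv.
  by apply: val_inj; rewrite rmorphXn rmorph1 /= -oG (unit_order uv' vu').
by split; [rewrite ox k1 expn1 | split=> //; exists d].
Qed.

End Realized.

Local Close Scope ring_scope.
Local Open Scope group_scope.

Lemma cyclic_isog_Zp (gT : finGroupType) (G : {group gT}) n :
  cyclic G -> #|G| = n -> G \isog Zp n.
Proof.
by case/cyclicP=> x -> <-; rewrite -orderE isog_sym Zp_isog.
Qed.

Lemma cyclic_realizable (p : nat) (gT : finGroupType) (G : {group gT}) :
    prime p -> p.-group G -> realizable G -> G :!=: 1 -> cyclic G ->
  [\/ exists2 k, 0 < k <= 3 & G \isog Zp (2 ^ k),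
      mersenne_prime p /\ G \isog Zp p
    | exists q : nat, fermat_prime q /\ G \isog Zp (q - 1)].
Proof.
move=> p_pr pG realG ntG cycG; have [x defG] := cyclicP cycG.
have Gx : x \in G by rewrite defG cycle_id.
have x_neq1 : x != 1 by apply: contraNneq ntG => x1; rewrite defG x1 cycle1.
have ox : #[x] = #|G| by rewrite orderE -defG.
have [R [f [fM f_inj f_unit unit_f]]] := realizable_nzRing realG ntG.
have [p2|odd_p] := even_prime p_pr; last first.
  have [oxp mers] := odd_realized fM f_inj f_unit unit_f p_pr odd_p pG Gx x_neq1.
  by apply: Or32; split=> //; apply: cyclic_isog_Zp; rewrite -?ox.
rewrite p2 in pG; have [k oG] := p_natP pG.
have k_gt0 : 0 < k by rewrite lt0n; apply: contraNneq x_neq1 => k0; rewrite -order_eq1 ox oG k0.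
have isoG : G \isog Zp (2 ^ k) by apply: cyclic_isog_Zp.
have [k_le2|k_gt2] := leqP k 2.
  by apply: Or31; exists k; rewrite // k_gt0 ltnW.
have [//|k3|q_pr] := self_centralizing_order fM f_inj f_unit unit_f Gx (etrans ox oG) k_gt2.
- by rewrite -defG.
- by apply: Or31; exists k; rewrite // k3.
apply: Or33; exists (2 ^ k).+1; split; last by rewrite subn1.
by split; rewrite ?oddS ?oddX /= ?gtn_eqF //; exists k; rewrite addn1.
Qed.

(** All elements other than 1 have order [p], so a cyclic subgroup has order 1 or
    [p], and [G] has order [p] or [p ^ 2] and exponent [p]. *)
Lemma odd_almost_cyclic_realizable (p : nat) (gT : finGroupType) (G : {group gT}) :
    prime p -> odd p -> p.-group G -> realizable G -> almost_cyclic p G ->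
  mersenne_prime p /\ (G \isog Zp p \/ G \isog setX (Zp p) (Zp p)).
Proof.
move=> p_pr odd_p pG realG [H [sHG cycH iGH]].
have ntG : G :!=: 1.
  by apply: contraTneq (prime_gt1 p_pr) => G1; rewrite -leqNgt -iGH -divgS // G1 cards1 leq_div.
have [R [f [fM f_inj f_unit unit_f]]] := realizable_nzRing realG ntG.
have elt x := odd_realized fM f_inj f_unit unit_f p_pr odd_p pG (x := x).
have [x Gx x_neq1] : exists2 x, x \in G & x != 1 by apply/trivgPn.
split; first by case: (elt x Gx x_neq1).
have [y defH] := cyclicP cycH; have oG := Lagrange sHG; rewrite iGH in oG.
have Gy : y \in G by rewrite (subsetP sHG) // defH cycle_id.
have [y1|/(elt y Gy)[oy _]] := eqVneq y 1.
  left; rewrite defH y1 cycle1 cards1 mul1n in oG.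
  by apply: cyclic_isog_Zp; rewrite ?prime_cyclic -?oG.
right; rewrite defH -orderE oy mulnn in oG.
have abelZ : p.-abelem (Zp p) by apply: prime_abelem; rewrite ?card_Zp ?prime_gt0.
have abelG : p.-abelem G.
  rewrite abelemE // (card_p2group_abelian p_pr (esym oG)); apply/exponentP => z Gz.
  have [->|/(elt z Gz)[oz _]] := eqVneq z 1; first by rewrite expg1n.
  by rewrite -oz expg_order.
rewrite (isog_abelem_card _ abelG) cardsX !card_Zp ?prime_gt0 // -oG mulnn eqxx andbT.
rewrite (dprod_abelem p (setX_dprod _ _)).
by rewrite -(isog_abelem (isog_setX1 _ _)) -(isog_abelem (isog_set1X _ _)) abelZ.
Qed.

(** * Groups with a cyclic subgroup of index 2 *)
Section IndexTwo.

Variables (gT : finGroupType) (G H : {group gT}).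
Hypotheses (sHG : H \subset G) (iGH : #|G : H| = 2).

Lemma index2_sqr z : z \in G -> z ^+ 2 \in H.
Proof.
move=> Gz; have nHG := normal_norm (index2_normal sHG iGH).
have Nz := subsetP nHG z Gz; apply: coset_idr; rewrite ?groupX // morphX //=.
apply/eqP; rewrite -order_dvdn -iGH -(card_quotient nHG).
by rewrite order_dvdG // mem_quotient.
Qed.

Lemma index2_max (K : {group gT}) z :
  H \subset K -> K \subset G -> z \in K -> z \notin H -> K :=: G.
Proof.
move=> sHK sKG Kz Hz; apply/eqP; rewrite eqEcard sKG -(Lagrange sHK) -(Lagrange sHG) iGH.
rewrite leq_pmul2l ?cardG_gt0 // indexg_gt1.
by apply: contra Hz => /subsetP/(_ z Kz).
Qed.

End IndexTwo.

(** Let [y] lie outside [H], which [x] generates. Then [y ^ 2 = x ^ i], where [i]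
    is even because otherwise [y] would generate [G]. So [y x ^ (- i / 2)] is an
    involution, and it generates a complement of [H]. *)
Lemma abelian_almost_cyclic2 (gT : finGroupType) (G H : {group gT}) :
    2.-group G -> abelian G -> ~~ cyclic G -> H \subset G -> cyclic H -> #|G : H| = 2 ->
  exists2 n, 0 < n & G \isog setX (Zp 2) (Zp (2 ^ n)).
Proof.
move=> pG abG ncycG sHG cycH iGH; have oG := Lagrange sHG; rewrite iGH in oG.
have [x defH] := cyclicP cycH.
have [n oH] := p_natP (pgroupS sHG pG).
have Hx : x \in H by rewrite defH cycle_id.
have [y Gy Hy] : exists2 y, y \in G & y \notin H.
  apply/subsetPn; apply: contraNN ncycG => sGH.
  by rewrite (_ : G = H) //; apply/val_inj/eqP; rewrite eqEsubset sGH.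
have Gx := subsetP sHG x Hx.
have cxy : commute x y by apply: (centsP abG).
have /cycleP[i y2] : y ^+ 2 \in <[x]> by rewrite -defH (index2_sqr sHG iGH).
have odd_i : ~~ odd i.
  apply: contra ncycG => odd_i; apply/cyclicP; exists y.
  rewrite -(index2_max sHG iGH (K := <[y]>) (z := y)) ?cycle_subG ?cycle_id //.
  rewrite defH cycle_subG; have : coprime #[x] i.
    by rewrite orderE -defH oH coprimeXl // coprime2n.
  rewrite -generator_coprime => /eqP/= defx.
  have : x \in <[x ^+ i]> by rewrite -defx cycle_id.
  by apply: (subsetP _ x); rewrite -y2 cycle_subG mem_cycle.
pose t := y * x ^- i./2.
have t2 : t ^+ 2 = 1.
  rewrite expgMn; last by apply/commuteV/commuteX/commute_sym.
  by rewrite y2 expgVn -expgM muln2 even_halfK // mulgV.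
have Gt : t \in G by rewrite groupM ?groupV ?groupX.
have Ht : t \notin H by rewrite groupMr ?groupV ?groupX.
have ot : #[t] = 2.
  by apply: nt_prime_order => //; apply: contraNneq Ht => ->; apply: group1.
have tiH : <[t]> :&: H = 1.
  by apply: prime_TIg; rewrite -?orderE ?ot // cycle_subG.
have defG : <[t]> \x H = G.
  rewrite dprodE //; last by apply: (centSS _ _ abG); rewrite ?cycle_subG.
  apply/eqP; rewrite eqEcard mul_subG ?cycle_subG //= TI_cardMg // -orderE ot.
  by rewrite mulnC oG.
exists n.
  rewrite lt0n; apply: contraNneq ncycG => n0; rewrite n0 in oH.
  by apply: prime_cyclic; rewrite -oG oH.
apply: (isog_dprod defG (setX_dprod _ _)).
  apply: isog_trans (isog_setX1 _ _); exact: cyclic_isog_Zp (cycle_cyclic t) ot.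
by apply: isog_trans (isog_set1X _ _); exact: cyclic_isog_Zp.
Qed.

(** [H] is normal, and it is its own centralizer because [G] is not abelian. So
    [self_centralizing_normalizer] excludes that the order of [H] exceeds 4. *)
Lemma nonabelian_almost_cyclic2 (gT : finGroupType) (G H : {group gT}) :
    2.-group G -> realizable G -> ~~ abelian G -> H \subset G -> cyclic H ->
    #|G : H| = 2 ->
  #|G| = 8.
Proof.
move=> pG realG nabG sHG cycH iGH; have oG := Lagrange sHG; rewrite iGH in oG.
have [k oH] := p_natP (pgroupS sHG pG); have [x defH] := cyclicP cycH.
have ntG : G :!=: 1 by apply: contraNneq nabG => ->; apply: abelian1.
have [R [f [fM f_inj f_unit unit_f]]] := realizable_nzRing realG ntG.
have Gx : x \in G by rewrite (subsetP sHG) // defH cycle_id.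
have nHG := normal_norm (index2_normal sHG iGH).
have cent_x : forall g, g \in G -> commute g x -> g \in <[x]>.
  move=> g Gg cgx; rewrite -defH; apply: contraR nabG => Hg.
  have sHCx : H \subset 'C_G[x] by rewrite subsetI sHG defH cycle_subG cent1id.
  have Cx : 'C_G[x] = G.
    by apply: (index2_max sHG iGH _ _ _ Hg) => //; rewrite ?subsetIl // inE Gg; apply/cent1P.
  have sHZ : H \subset 'Z(G).
    by rewrite defH cycle_subG inE Gx -sub_cent1 -{1}Cx subsetIr.
  have CgG : 'C_G[g] = G.
    apply: (index2_max sHG iGH _ (subsetIl _ _) _ Hg); last by apply/setIP; rewrite cent1id.
    by rewrite subsetI sHG defH cycle_subG; apply/cent1P.
  have sGCg : G \subset 'C[g] by rewrite -{1}CgG subsetIr.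
  have Zg : g \in 'Z(G) by rewrite inE Gg -sub_cent1.
  by rewrite -(index2_max sHG iGH sHZ (subsetIl _ _) Zg Hg) center_abelian.
have ox : #[x] = (2 ^ k)%N by rewrite orderE -defH.
have [y Gy Hy] : exists2 y, y \in G & y \notin <[x]>.
  apply/subsetPn; rewrite -defH; apply: contraNN nabG => sGH.
  by apply: abelianS sGH _; apply: cyclic_abelian.
have [k_le2|k_gt2] := leqP k 2; last first.
  case/negP: Hy; apply: (cent_x _ Gy).
  apply: (self_centralizing_normalizer fM f_inj f_unit unit_f Gx ox k_gt2 cent_x pG Gy).
    by rewrite -defH memJ_norm ?(subsetP nHG) // defH cycle_id.
  by rewrite -defH (index2_sqr sHG iGH).
have : ~~ (logn 2 #|G| <= 2) by apply: contra nabG; apply: p2group_abelian pG.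
rewrite -oG oH -expnSr pfactorK // -ltnNge ltnS => k_ge2.
by have /eqP-> : k == 2 by rewrite eqn_leq k_le2.
Qed.

Lemma extremal_order8 (gT : finGroupType) (G H : {group gT}) :
    #|G| = 8 -> ~~ abelian G -> H \subset G -> cyclic H -> #|G : H| = 2 ->
  G \isog 'D_8 \/ G \isog 'Q_8.
Proof.
move=> oG nabG sHG cycH iGH; have pG : 2.-group G by rewrite /pgroup oG.
have expn8 n : (2 ^ n)%N = 8 -> n = 3 by move/(@expnI 2 isT n 3).
have [|] := orP (maximal_cycle_extremal pG nabG cycH sHG iGH).
  move/eqP/modular_group_classP=> [p p_pr [n n_gt isoG]].
  have n_gt2 : 2 < n by apply: leq_trans n_gt; rewrite leq_addl.
  have := card_isog isoG; rewrite oG card_modular_group // => pn.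
  have p2 : p = 2.
    have : p %| 2 ^ 3 by rewrite -[(2 ^ 3)%N]/8 pn dvdn_exp // ltnW // ltnW.
    by rewrite Euclid_dvdX // andbT dvdn_prime2 // => /eqP.
  by move: n_gt pn; rewrite p2 => n_gt /esym/expn8 n3; rewrite n3 in n_gt.
case/andP=> _; rewrite /extremal2 !inE => /or3P[] /eqP.
- move/dihedral_classP=> [n n_gt isoG]; have := card_isog isoG.
  by rewrite oG card_2dihedral // => /esym/expn8 n3; left; rewrite n3 in isoG.
- move/semidihedral_classP=> [n n_gt3 isoG]; have := card_isog isoG.
  by rewrite oG card_semidihedral // => /esym/expn8 n3; rewrite n3 in n_gt3.
- move/quaternion_classP=> [n n_gt isoG]; have := card_isog isoG.
  by rewrite oG card_quaternion // => /esym/expn8 n3; right; rewrite n3 in isoG.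
Qed.

Local Open Scope ring_scope.

(** * Cochains as functions of sequences *)
Section SeqCochains.

Variables (T : finGroupType) (F : fieldType).
Implicit Types (g h : seq T -> F) (l w : seq T) (x y : T).

Fixpoint del k l : seq T :=
  match k, l with
  | 0%N, _ :: l' => l'
  | k'.+1, x :: l' => x :: del k' l'
  | _, [::] => [::]
  end.

(** On functions of sequences of any length, the coboundary and its contracting
    homotopy [cone] can be iterated without transporting between degrees. *)
Definition delta g l : F := \sum_(k < size l) (-1) ^+ k * g (del k l).
Definition cone x g w : F := g (x :: w).
Definition shift x g l : F := g [seq (x * y)%g | y <- l].

Lemma delta_cone x g w : delta g (x :: w) = g w - delta (cone x g) w.
Proof.
rewrite /delta big_ord_recl expr0 mul1r; congr (_ + _).
by rewrite -sumrN; apply: eq_bigr => k _; rewrite exprS mulN1r mulNr.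
Qed.

Lemma size_del k l : (k < size l)%N -> size (del k l) = (size l).-1.
Proof.
elim: l k => // x l IH [|k] //=; rewrite ltnS => lt_k; rewrite IH //.
by case: l lt_k {IH}.
Qed.

Lemma eq_delta g h n l : size l = n.+1 ->
  (forall l', size l' = n -> g l' = h l') -> delta g l = delta h l.
Proof.
move=> sl gh; apply: eq_bigr => k _; congr (_ * _); apply: gh.
by rewrite size_del ?sl.
Qed.

Lemma delta_sub g h l : delta (fun w => g w - h w) l = delta g l - delta h l.
Proof.
by rewrite /delta -sumrB; apply: eq_bigr => k _; rewrite mulrBr.
Qed.

Lemma delta_delta g l : delta (delta g) l = 0.
Proof.
elim: l g => [|x l IH] g; first by rewrite /delta big_ord0.
rewrite delta_cone; have -> : delta (cone x (delta g)) l = delta g l - delta (delta (cone x g)) l.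
  by rewrite -delta_sub; apply: eq_bigr => k _; rewrite /cone delta_cone.
by rewrite IH subr0 subrr.
Qed.

Lemma del_map x k l : del k [seq (x * y)%g | y <- l] = [seq (x * y)%g | y <- del k l].
Proof. by elim: l k => [|y l IH] [|k] //=; rewrite IH. Qed.

Lemma delta_shift x g l : delta (shift x g) l = shift x (delta g) l.
Proof. by rewrite /shift /delta size_map; apply: eq_bigr => k _; rewrite del_map. Qed.

Lemma nth_del k l i : nth 1%g (del k l) i = nth 1%g l (bump k i).
Proof.
elim: l k i => [|x l IH] [|k] [|i] //=; rewrite ?nth_nil ?IH //.
by rewrite bumpS.
Qed.

(** The default value 1 only matters for sequences of length at most [n]. *)
Definition seq_cochain n (f : cochain F T n) : seq T -> F :=
  fun l => f [ffun i : 'I_n.+1 => nth 1%g l i].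

Lemma seq_cochain_cobd n (f : cochain F T n) l : size l = n.+2 ->
  seq_cochain (cobd f) l = delta (seq_cochain f) l.
Proof.
move=> sl; rewrite /seq_cochain /delta ffunE sl; apply: eq_bigr => k _.
congr (_ * f _); apply/ffunP => i; rewrite !ffunE nth_del //.
Qed.

Definition simplex_seq n (s : simplex T n) : seq T := [seq s i | i <- enum 'I_n.+1].

Lemma size_simplex_seq n (s : simplex T n) : size (simplex_seq s) = n.+1.
Proof. by rewrite size_map size_enum_ord. Qed.

Lemma seq_cochainE n (f : cochain F T n) s : seq_cochain f (simplex_seq s) = f s.
Proof.
congr (f _); apply/ffunP => i; rewrite ffunE (nth_map ord0) ?size_enum_ord //.
by rewrite nth_ord_enum.
Qed.

Lemma cobd_cobd n (f : cochain F T n) : cobd (cobd f) = 0.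
Proof.
apply/ffunP => s; rewrite [RHS]ffunE -seq_cochainE seq_cochain_cobd ?size_simplex_seq //.
rewrite (eq_delta (h := delta (seq_cochain f)) (size_simplex_seq s)) ?delta_delta //.
exact: seq_cochain_cobd.
Qed.

Lemma seq_cochain_shift n x (f : cochain F T n) l : size l = n.+1 ->
  seq_cochain (translate x f) l = shift x (seq_cochain f) l.
Proof.
move=> sl; rewrite /shift /seq_cochain ffunE; congr (f _); apply/ffunP => i.
by rewrite !ffunE (nth_map 1%g) ?sl.
Qed.

Lemma cobd_translate n x (f : cochain F T n) : cobd (translate x f) = translate x (cobd f).
Proof.
apply/ffunP => s; rewrite -!seq_cochainE seq_cochain_shift ?size_simplex_seq //.
rewrite seq_cochain_cobd ?size_simplex_seq // /shift seq_cochain_cobd; last first.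
  by rewrite size_map size_simplex_seq.
rewrite -[RHS](delta_shift x); apply: (eq_delta (size_simplex_seq s)).
by move=> l sl; apply: seq_cochain_shift.
Qed.

(** * Evaluation on a resolution for a product of two cyclic groups *)

(** The differential in degree [k] of the periodic resolution of the cyclic group
    of order [p] generated by [x], acting on functions: it is [x - 1] for odd
    [k], and the norm [1 + x + ... + x ^ (p - 1)] for even [k]. *)
Definition opstep p x (k : nat) g l : F :=
  if odd k then shift x g l - g l else \sum_(i < p) shift (x ^+ i)%g g l.

Lemma shift_comp x y g l : shift x (shift y g) l = shift (y * x)%g g l.
Proof. by rewrite /shift -map_comp; congr (g _); apply: eq_map => z /=; rewrite mulgA. Qed.

Lemma opstep_linear p x k c g h l :
  opstep p x k (fun w => c * g w + h w) l = c * opstep p x k g l + opstep p x k h l.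
Proof.
rewrite /opstep /shift; case: odd; first by ring.
by rewrite mulr_sumr -big_split.
Qed.

Lemma opstep_delta p x k g l : opstep p x k (delta g) l = delta (opstep p x k g) l.
Proof.
rewrite /opstep; case: odd; first by rewrite delta_sub delta_shift.
transitivity (\sum_(i < p) delta (shift (x ^+ i)%g g) l).
  by apply: eq_bigr => i _; rewrite delta_shift.
by rewrite /delta exchange_big; apply: eq_bigr => j _ /=; rewrite mulr_sumr.
Qed.

Lemma opstep_comm p x y k k' g l : commute x y ->
  opstep p x k (opstep p y k' g) l = opstep p y k' (opstep p x k g) l.
Proof.
move=> cxy; have sh x1 y1 h w : commute x1 y1 ->
    shift x1 (shift y1 h) w = shift y1 (shift x1 h) w.
  by move=> c1; rewrite !shift_comp c1.
have cxX i : commute (x ^+ i)%g y by apply/commute_sym/commuteX/commute_sym.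
have cyX i : commute x (y ^+ i)%g by apply: commuteX.
have cX i j : commute (x ^+ i)%g (y ^+ j)%g by apply: commuteX2.
have shD z h h' w : shift z (fun v => h v - h' v) w = shift z h w - shift z h' w by [].
have shS z (h : 'I_p -> seq T -> F) w :
  shift z (fun v => \sum_i h i v) w = \sum_i shift z (h i) w by [].
rewrite /opstep; case: (odd k); case: (odd k'); rewrite ?shD ?shS.
- by rewrite sh //; ring.
- by rewrite -sumrB; apply: eq_bigr => i _; rewrite shD sh.
- by rewrite -sumrB; apply: eq_bigr => i _; rewrite shD sh.
- under eq_bigr do rewrite shS.
  rewrite exchange_big; apply: eq_bigr => i _; rewrite shS.
  by apply: eq_bigr => j _; rewrite sh.
Qed.

Lemma opstep_opstepS p x k g l : (x ^+ p = 1)%g -> opstep p x k (opstep p x k.+1 g) l = 0.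
Proof.
move=> xp; pose u i := shift (x ^+ i)%g g l.
have tel : \sum_(i < p) (u i.+1 - u i) = 0.
  rewrite -(big_mkord xpredT (fun i => u i.+1 - u i)) telescope_sumr // /u xp expg0.
  by rewrite subrr.
have uS i : u i.+1 = shift x (shift (x ^+ i)%g g) l by rewrite shift_comp -expgSr.
have uS' i : u i.+1 = shift (x ^+ i)%g (shift x g) l by rewrite shift_comp -expgS.
rewrite /opstep /=; case: (odd k) => /=; rewrite -[RHS]tel ?sumrB.
  by rewrite [shift x _ l](_ : _ = \sum_(i < p) u i.+1) //; apply: eq_bigr => i _; rewrite uS.
by congr (_ - _); apply: eq_bigr => i _; rewrite uS'.
Qed.

Section RankTwo.

Variables (p : nat) (s t : T).
Hypotheses (sp : (s ^+ p = 1)%g) (tp : (t ^+ p = 1)%g) (cst : commute s t).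

(** The tensor product of the periodic resolutions for [s] and [t] has one
    generator [e a b] in each bidegree, whose boundary is [opstep s a] applied to
    [e (a - 1) b] plus [(-1) ^ a] times [opstep t b] applied to [e a (b - 1)]. A
    chain map to the bar resolution sends [e 0 0] to the vertex 1, and [e a b] to
    the cone with apex 1 over the image of its boundary. [pairing a b g] is the
    value of [g] on the image of [e a b]; [pairingE] is the recursion just
    described. *)
Fixpoint pairing a b g : F :=
  match a with
  | 0%N => (fix pairing0 b g : F :=
      match b with
      | 0%N => g [:: 1%g]
      | b'.+1 => pairing0 b' (opstep p t b (cone 1%g g))
      end) b g
  | a'.+1 => (fix pairingS b g : F :=
      match b with
      | 0%N => pairing a' 0 (opstep p s a (cone 1%g g))
      | b'.+1 => pairing a' b (opstep p s a (cone 1%g g))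
               + (-1) ^+ a * pairingS b' (opstep p t b (cone 1%g g))
      end) b g
  end.

(** The value of [g] on the image of the boundary of [e a b]. *)
Definition boundary_pairing a b g : F :=
  (if a is a'.+1 then pairing a' b (opstep p s a g) else 0)
  + (-1) ^+ a * (if b is b'.+1 then pairing a b' (opstep p t b g) else 0).

Lemma pairingE a b g : pairing a b g =
  if (a + b == 0)%N then g [:: 1%g] else boundary_pairing a b (cone 1%g g).
Proof.
case: a b => [|a] [|b] //; rewrite /boundary_pairing /=.
- by rewrite add0r expr0 mul1r.
- by rewrite mulr0 addr0.
Qed.

Arguments pairing : simpl never.
Arguments opstep : simpl never.

Definition eq_on n g h := forall w, size w = n -> g w = h w.

Lemma eq_opstep n x k g h : eq_on n g h -> eq_on n (opstep p x k g) (opstep p x k h).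
Proof.
move=> gh w sw; rewrite /opstep /shift; case: odd; first by rewrite !gh ?size_map.
by apply: eq_bigr => i _; rewrite gh ?size_map.
Qed.

Lemma eq_pairing n a b g h : (a + b)%N = n ->
  (forall w, size w = n -> g (1%g :: w) = h (1%g :: w)) -> pairing a b g = pairing a b h.
Proof.
elim: n a b g h => [|n IH] a b g h ab gh; rewrite !pairingE ab /=.
  by apply: (gh [::]).
have {}gh x k : eq_on n.+1 (opstep p x k (cone 1%g g)) (opstep p x k (cone 1%g h)).
  by apply: eq_opstep => w sw; apply: gh.
rewrite /boundary_pairing; congr (_ + _ * _).
  case: a ab => // a [ab]; apply: IH => // w sw; apply: gh; rewrite /= sw //.
by case: b ab => // b; rewrite addnS => -[ab]; apply: IH => // w sw; apply: gh; rewrite /= sw.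
Qed.

Lemma pairing_linear a b c g h :
  pairing a b (fun w => c * g w + h w) = c * pairing a b g + pairing a b h.
Proof.
elim: {a b}(a + b)%N {-2}a {-2}b (erefl (a + b)%N) g h => [|n IH] a b ab g h;
  rewrite !pairingE ab //=.
have op x k a' b' : (a' + b')%N = n ->
    pairing a' b' (opstep p x k (cone 1%g (fun w => c * g w + h w))) =
    c * pairing a' b' (opstep p x k (cone 1%g g)) + pairing a' b' (opstep p x k (cone 1%g h)).
  move=> ab'; rewrite -IH //; apply: (eq_pairing ab') => w _.
  by rewrite -opstep_linear.
rewrite /boundary_pairing.
case: a ab => [|a] ab; case: b ab => [|b] ab; rewrite ?op ?mulr0 ?mul0r ?addr0 ?add0r //; try ring.
all: by move: ab; rewrite ?addn0 ?addSn ?addnS => -[].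
Qed.

Lemma boundary_pairing_linear a b c g h :
  boundary_pairing a b (fun w => c * g w + h w) =
  c * boundary_pairing a b g + boundary_pairing a b h.
Proof.
have op x k a' b' : pairing a' b' (opstep p x k (fun w => c * g w + h w)) =
    c * pairing a' b' (opstep p x k g) + pairing a' b' (opstep p x k h).
  rewrite -pairing_linear; apply: (eq_pairing (erefl _)) => w _.
  by rewrite -opstep_linear.
by rewrite /boundary_pairing; case: a => [|a]; case: b => [|b]; rewrite ?op; ring.
Qed.

Lemma pairing0 a b g : (forall w, size w = (a + b)%N -> g (1%g :: w) = 0) -> pairing a b g = 0.
Proof.
move=> g0; have := pairing_linear a b (-1) g g; rewrite mulN1r addNr => <-.
by apply: (eq_pairing (erefl _)) => w sw; rewrite g0 // mulr0 addr0.
Qed.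

Lemma eq_boundary_pairing a b g h :
  eq_on (a + b) g h -> boundary_pairing a b g = boundary_pairing a b h.
Proof.
move=> gh; rewrite /boundary_pairing; congr (_ + _ * _).
  case: a gh => // a gh; apply: (eq_pairing (erefl _)) => w sw.
  by apply: (eq_opstep _ _ gh); rewrite /= sw.
case: b gh => // b gh; apply: (eq_pairing (erefl _)) => w sw.
by apply: (eq_opstep _ _ gh); rewrite /= sw addnS.
Qed.

(** This says that [e a b |-> pairing a b] is a chain map. By [delta_cone], it is
    so because the boundary of the boundary of [e a b] is 0, which comes from
    [opstep_opstepS] and [opstep_comm]. *)
Lemma pairing_delta n a b g : (a + b = n.+1)%N ->
  pairing a b (delta g) = boundary_pairing a b g.
Proof.
elim: n a b g => [|n IH] a b g ab; rewrite pairingE ab /=; set h := cone 1%g g.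
all: have -> : boundary_pairing a b (cone 1%g (delta g)) =
    boundary_pairing a b g - boundary_pairing a b (delta h).
  1,3: rewrite -[RHS]addrC -mulN1r -boundary_pairing_linear;
       apply: eq_boundary_pairing => w _; rewrite [LHS]delta_cone mulN1r addrC //.
all: suff -> : boundary_pairing a b (delta h) = 0 by rewrite subr0.
  have op x : opstep p x 1 (delta h) [:: 1%g] = 0.
    by rewrite /opstep /shift /delta !big_ord_recl !big_ord0 /= subrr.
  rewrite /boundary_pairing; case: a b ab => [|[|a]] [|[|b]] //= _.
    by rewrite pairingE /= op mulr0 addr0.
  by rewrite pairingE /= op mulr0 addr0.
have pair_delta x k a' b' : (a' + b' = n.+1)%N ->
    pairing a' b' (opstep p x k (delta h)) = boundary_pairing a' b' (opstep p x k h).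
  move=> ab'; rewrite -(IH _ _ _ ab'); apply: (eq_pairing ab') => w _.
  by rewrite opstep_delta.
have sqs k a' b' : pairing a' b' (opstep p s k (opstep p s k.+1 h)) = 0.
  by apply: pairing0 => w _; apply: opstep_opstepS.
have sqt k a' b' : pairing a' b' (opstep p t k (opstep p t k.+1 h)) = 0.
  by apply: pairing0 => w _; apply: opstep_opstepS.
have swap k k' a' b' : pairing a' b' (opstep p t k (opstep p s k' h)) =
    pairing a' b' (opstep p s k' (opstep p t k h)).
  by apply: (eq_pairing (erefl _)) => w _; apply/opstep_comm/commute_sym.
rewrite {1}/boundary_pairing.
case: a b ab => [|a] [|b] //; rewrite ?addn0 ?add0n ?addSn ?addnS => -[ab].
- rewrite pair_delta // /boundary_pairing ab sqt.
  by rewrite !(mulr0, addr0).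
- rewrite pair_delta ?addn0 // /boundary_pairing ab sqs.
  by rewrite !(mulr0, addr0).
have [ab1 ab2] : (a + b.+1 = n.+1)%N /\ (a.+1 + b = n.+1)%N by rewrite addnS addSn ab.
rewrite (pair_delta _ _ _ _ ab1) (pair_delta _ _ _ _ ab2) /boundary_pairing /= swap.
have zs : (if a is a'.+1 then pairing a' b.+1 (opstep p s a (opstep p s a.+1 h)) else 0) = 0.
  by case: (a) => // a'; apply: sqs.
have zt : (if b is b'.+1 then pairing a.+1 b' (opstep p t b (opstep p t b.+1 h)) else 0) = 0.
  by case: (b) => // b'; apply: sqt.
by rewrite zs zt exprS; ring.
Qed.

(** On an invariant cochain [x - 1] acts as 0, and so does the norm, which is the
    multiplication by [p]. *)
Lemma pairing_coboundary n a b (h : cochain F T n) : (a + b = n.+1)%N -> p%:R = 0 :> F ->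
    translate s h = h -> translate t h = h ->
  pairing a b (seq_cochain (cobd h)) = 0.
Proof.
move=> ab p0 hs ht.
have inv x i l : translate x h = h -> size l = n.+1 ->
    shift (x ^+ i)%g (seq_cochain h) l = seq_cochain h l.
  move=> hx; elim: i l => [|i IH] l sl.
    by rewrite /shift expg0 (eq_map (g := id)) ?map_id // => y; rewrite mul1g.
  rewrite expgS -shift_comp -[RHS]IH // {1}/shift -seq_cochain_shift ?size_map //.
  by rewrite hx.
have op0 x k : translate x h = h -> eq_on n.+1 (opstep p x k (seq_cochain h)) (fun=> 0).
  move=> hx l sl; rewrite /opstep; case: odd; first by rewrite -{1}[x]expg1 inv ?subrr.
  by under eq_bigr do rewrite inv //; rewrite sumr_const card_ord -mulr_natl p0 mul0r.
have -> : pairing a b (seq_cochain (cobd h)) = pairing a b (delta (seq_cochain h)).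
  by apply: (eq_pairing ab) => w sw; rewrite seq_cochain_cobd //= sw.
rewrite (pairing_delta _ ab) /boundary_pairing.
have -> : (if a is a'.+1 then pairing a' b (opstep p s a (seq_cochain h)) else 0) = 0.
  by case: a ab => // a [ab]; apply: pairing0 => w sw; apply: op0; rewrite //= sw ab.
have -> : (if b is b'.+1 then pairing a b' (opstep p t b (seq_cochain h)) else 0) = 0.
  case: b ab => // b; rewrite addnS => -[ab].
  by apply: pairing0 => w sw; apply: op0; rewrite //= sw ab.
by rewrite mulr0 addr0.
Qed.

(** Here [g] stands for the cup product of a cochain [y] of degree 2 with an
    invariant cochain [c]. Among the terms of the image of [e (A + 2) B], those
    whose first two edges are not both in the direction of [s] are annihilated by
    [y], and the values of [y] on the other pairs of edges add up to 1. *)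
Lemma pairing_cup_s A B g c (y : T -> T -> T -> F) :
    ~~ odd A -> ~~ odd B ->
    (forall x0 x1 x2 w, size w = (A + B)%N ->
       g [:: x0, x1, x2 & w] = y x0 x1 x2 * c (x2 :: w)) ->
    (forall i w, size w = (A + B).+1 -> shift (s ^+ i)%g c w = c w) ->
    (forall i x, y 1%g (t ^+ i)%g x = 0) ->
    (forall i j, y 1%g (s ^+ i)%g (s ^+ i * t ^+ j)%g = 0) ->
    \sum_(i < p) y 1%g (s ^+ i)%g (s ^+ i.+1)%g = 1 ->
  pairing A.+2 B g = pairing A B c.
Proof.
move=> evA evB gE cE yt yst y1.
rewrite pairingE /= /boundary_pairing /=.
set G := opstep p s A.+2 _.
have GE w : size w = (A + B).+2 -> G w = \sum_(i < p) g (1%g :: [seq (s ^+ i * y)%g | y <- w]).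
  by move=> _; rewrite /G /opstep /= negbK (negbTE evA).
have -> : (if B is B'.+1 then pairing A.+2 B' (opstep p t B (cone 1%g g)) else 0) = 0.
  case: B evB gE {cE GE} => //= B evB gE; apply: pairing0 => w sw.
  rewrite /opstep /= (negbTE evB) big1 // => i _; rewrite /shift /cone /= mulg1.
  by case: w sw => // x w [sw]; rewrite /= gE ?yt ?mul0r // size_map sw addnS.
rewrite mulr0 addr0 pairingE /= /boundary_pairing /=.
have -> : (if B is B'.+1 then pairing A.+1 B' (opstep p t B (cone 1%g G)) else 0) = 0.
  case: B evB gE GE {cE} => //= B evB gE GE; apply: pairing0 => w sw.
  rewrite /opstep /= (negbTE evB) big1 // => i _; rewrite /shift /cone.
  rewrite GE ?big1 //= ?size_map ?sw ?addnS // => j _; rewrite !mulg1 gE ?yst ?mul0r //.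
  by rewrite !size_map sw addnS.
rewrite mulr0 addr0; apply: (eq_pairing (erefl _)) => w sw.
rewrite /opstep /= evA /shift /cone !GE ?size_map /= ?size_map ?sw // mulg1.
rewrite -sumrB -[RHS]mul1r -y1 mulr_suml; apply: eq_bigr => i _.
rewrite !mulg1 !gE ?size_map //.
have := yst i 0; rewrite expg0 mulg1 => ->; rewrite mul0r subr0 -expgSr.
rewrite -[in RHS](cE i.+1) /= ?sw // /shift /= mulg1 expgSr; congr (_ * c (_ :: _)).
by rewrite -map_comp; apply: eq_map => z /=; rewrite mulgA.
Qed.

(** The counterpart of [pairing_cup_s] in the direction of [t]; the sign
    [(-1) ^ A] is 1 since [A] is even. *)
Lemma pairing_cup_t A B g c (y : T -> T -> T -> F) :
    ~~ odd A -> ~~ odd B ->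
    (forall x0 x1 x2 w, size w = (A + B)%N ->
       g [:: x0, x1, x2 & w] = y x0 x1 x2 * c (x2 :: w)) ->
    (forall i w, size w = (A + B).+1 -> shift (t ^+ i)%g c w = c w) ->
    (forall i x, y 1%g (s ^+ i)%g x = 0) ->
    (forall i j, y 1%g (t ^+ i)%g (t ^+ i * s ^+ j)%g = 0) ->
    \sum_(i < p) y 1%g (t ^+ i)%g (t ^+ i.+1)%g = 1 ->
  pairing A B.+2 g = pairing A B c.
Proof.
move=> evA evB gE cE ys yts y1.
have sgn : (-1) ^+ A = 1 :> F by rewrite -signr_odd (negbTE evA).
rewrite pairingE !addnS /= /boundary_pairing /= sgn mul1r.
set G := opstep p t B.+2 _.
have GE w : G w = \sum_(i < p) g (1%g :: [seq (t ^+ i * y)%g | y <- w]).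
  by rewrite /G /opstep /= negbK (negbTE evB).
have -> : (if A is A'.+1 then pairing A' B.+2 (opstep p s A (cone 1%g g)) else 0) = 0.
  case: A evA gE {cE sgn} => //= A evA gE; apply: pairing0 => w sw.
  rewrite /opstep /= (negbTE evA) big1 // => i _; rewrite /shift /cone /= mulg1.
  by case: w sw => [|x w]; rewrite !addnS // => -[sw]; rewrite /= gE ?ys ?mul0r // size_map sw.
rewrite add0r pairingE !addnS /= /boundary_pairing /= sgn mul1r.
have -> : (if A is A'.+1 then pairing A' B.+1 (opstep p s A (cone 1%g G)) else 0) = 0.
  case: A evA gE {cE sgn} => //= A evA gE; apply: pairing0 => w sw.
  rewrite /opstep /= (negbTE evA) big1 // => i _; rewrite /shift /cone.
  rewrite GE big1 //= => j _; rewrite !mulg1 gE ?yts ?mul0r //.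
  by rewrite !size_map sw addnS.
rewrite add0r; apply: (eq_pairing (erefl _)) => w sw.
rewrite /opstep /= evB /shift /cone !GE /= mulg1.
rewrite -sumrB -[RHS]mul1r -y1 mulr_suml; apply: eq_bigr => i _.
rewrite !mulg1 !gE ?size_map //.
have := yts i 0; rewrite expg0 mulg1 => ->; rewrite mul0r subr0 -expgSr.
rewrite -[in RHS](cE i.+1) /= ?sw // /shift /= mulg1 expgSr; congr (_ * c (_ :: _)).
by rewrite -map_comp; apply: eq_map => z /=; rewrite mulgA.
Qed.

(** The first edge of every term of the image of [e 0 (B + 1)] is in the direction
    of [t]. *)
Lemma pairing_cup_s0 B g c (y : T -> T -> T -> F) : odd B ->
    (forall x0 x1 x2 w, size w = B.-1 -> g [:: x0, x1, x2 & w] = y x0 x1 x2 * c (x2 :: w)) ->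
    (forall i x, y 1%g (t ^+ i)%g x = 0) ->
  pairing 0 B.+1 g = 0.
Proof.
move=> oddB gE yt; rewrite pairingE /= /boundary_pairing add0r expr0 mul1r.
apply: pairing0 => w sw; rewrite /opstep /= oddB big1 // => i _.
rewrite /shift /cone /= mulg1; case: w sw => [|x w]; first by case: B oddB {gE}.
by move=> /= sw; rewrite gE ?yt ?mul0r // size_map -[B]/(0 + B)%N -sw.
Qed.

Lemma pairing_cup_t0 A g c (y : T -> T -> T -> F) : odd A ->
    (forall x0 x1 x2 w, size w = A.-1 -> g [:: x0, x1, x2 & w] = y x0 x1 x2 * c (x2 :: w)) ->
    (forall i x, y 1%g (s ^+ i)%g x = 0) ->
  pairing A.+1 0 g = 0.
Proof.
move=> oddA gE ys; rewrite pairingE /= /boundary_pairing mulr0 addr0.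
apply: pairing0 => w sw; rewrite /opstep /= oddA big1 // => i _.
rewrite /shift /cone /= mulg1; case: w sw => [|x w]; first by case: A oddA {gE}.
by rewrite addn0 => /= sw; rewrite gE ?ys ?mul0r // size_map -sw.
Qed.

End RankTwo.

(** * Bockstein classes and their products *)
Section CarryClass.

Variable (p : nat).
Hypothesis p_gt0 : (0 < p)%N.
Implicit Types al be : T -> nat.

(** For a function [al] that behaves as a digit in base [p], [digit_diff al] is a
    cocycle of degree 1 modulo [p], and [carry al] is its Bockstein: the carry in
    the addition of the differences along two consecutive edges. *)
Definition digit_diff al x y : nat := ((al y + (p - al x)) %% p)%N.
Definition carry al x y z : nat := ((digit_diff al x y + digit_diff al y z) %/ p)%N.

Definition carry_cochain al : cochain F T 2 :=
  [ffun u : simplex T 2 => (carry al (u (inord 0)) (u (inord 1)) (u (inord 2)))%:R].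

Lemma digit_diff_add al x y z : (forall v, al v < p)%N ->
  digit_diff al x z = ((digit_diff al x y + digit_diff al y z) %% p)%N.
Proof.
move=> al_lt; rewrite /digit_diff modnDm.
have -> : (al y + (p - al x) + (al z + (p - al y)) = al z + (p - al x) + p)%N.
  by have := al_lt x; have := al_lt y; lia.
by rewrite modnDr.
Qed.

(** The total carry in the addition of three digits does not depend on the order
    of the two additions. *)
Lemma carry_cocycle al : (forall v, al v < p)%N -> cobd (carry_cochain al) = 0.
Proof.
move=> al_lt; apply/ffunP => u; rewrite cobdE [RHS]ffunE.
have liftE k i : (k < 4)%N -> (i < 3)%N -> lift (inord k : 'I_4) (inord i : 'I_3) = inord (bump k i).
  move=> lt_k lt_i; apply: val_inj; rewrite /= !inordK //.
  by rewrite /bump; case: (leqP k i) => _ /=; lia.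
rewrite !big_nat_recr //= big_geq // add0r !ffunE !liftE // /bump /= /carry.
set x0 := u (inord 0); set x1 := u (inord 1); set x2 := u (inord 2); set x3 := u (inord 3).
rewrite (@digit_diff_add al x0 x1 x2) // (@digit_diff_add al x1 x2 x3) //.
set a := digit_diff al x0 x1; set b := digit_diff al x1 x2; set c := digit_diff al x2 x3.
have eq_carry : ((b + c) %/ p + (a + (b + c) %% p) %/ p = (a + b) %/ p + ((a + b) %% p + c) %/ p)%N.
  rewrite -divnMDl // -[RHS]divnMDl // addnCA -divn_eq.
  by rewrite [in RHS]addnA -divn_eq addnA.
have := congr1 (fun n => n%:R : F) eq_carry; rewrite /= !natrD => /eqP.
by rewrite -subr_eq0 => /eqP <-; ring.
Qed.

Lemma digit_diff_xx al x : (forall v, al v < p)%N -> digit_diff al x x = 0%N.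
Proof. by move=> al_lt; rewrite /digit_diff subnKC ?modnn // ltnW. Qed.

Lemma carry_eq0l al x y z : (forall v, al v < p)%N -> al x = al y -> carry al x y z = 0%N.
Proof.
move=> al_lt xy; rewrite /carry {1}/digit_diff -xy -/(digit_diff al x x) digit_diff_xx //.
by rewrite add0n divn_small // ltn_mod.
Qed.

Lemma carry_eq0r al x y z : (forall v, al v < p)%N -> al y = al z -> carry al x y z = 0%N.
Proof.
move=> al_lt yz; rewrite /carry /(digit_diff al y z) -yz -/(digit_diff al y y) digit_diff_xx //.
by rewrite addn0 divn_small // ltn_mod.
Qed.

Lemma digit_diff_shift al x c : (forall v, al v < p)%N ->
    (forall v, al (x * v)%g = (al v + c) %% p)%N ->
  forall y z, digit_diff al (x * y)%g (x * z)%g = digit_diff al y z.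
Proof.
move=> al_lt al_x y z; rewrite /digit_diff !al_x.
have le m : (m %% p <= p)%N by rewrite ltnW // ltn_mod.
apply/eqP; rewrite -(eqn_modDr ((al y + c) %% p)) -addnA subnK // modnDr modn_mod.
rewrite -[(p - al y)%N](addnK (al y)) subnK ?(ltnW (al_lt _)) //.
rewrite modnDmr; apply/eqP.
have -> : (al z + (p - al y) + (al y + c) = al z + c + p)%N by have := al_lt y; lia.
by rewrite modnDr.
Qed.

Lemma translate_carry al x c : (forall v, al v < p)%N ->
    (forall v, al (x * v)%g = (al v + c) %% p)%N ->
  translate x (carry_cochain al) = carry_cochain al.
Proof.
move=> al_lt al_x; apply/ffunP => u; rewrite !ffunE /carry.
by rewrite !(digit_diff_shift al_lt al_x).
Qed.

Lemma seq_cochain_cup_carry al n (f : cochain F T n) x0 x1 x2 w :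
  seq_cochain (cup (carry_cochain al) f) [:: x0, x1, x2 & w] =
  (carry al x0 x1 x2)%:R * seq_cochain f (x2 :: w).
Proof.
rewrite {1}/seq_cochain ffunE; congr (_ * f _).
  by rewrite !ffunE !inordK.
apply/ffunP => i; rewrite !ffunE inordK //; exact: (ltn_ord i).
Qed.

Section Monomials.

Variables (s t : T) (al be : T -> nat).
Hypotheses (sp : (s ^+ p = 1)%g) (tp : (t ^+ p = 1)%g) (cst : commute s t).
Hypotheses (p_gt1 : (1 < p)%N) (al_lt : forall v, (al v < p)%N) (be_lt : forall v, (be v < p)%N).
(* The summands 0 give these conditions the common form that [translate_carry]
   expects. *)
Hypotheses (al_s : forall v, (al (s * v)%g = (al v + 1) %% p)%N)
           (al_t : forall v, (al (t * v)%g = (al v + 0) %% p)%N)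
           (be_s : forall v, (be (s * v)%g = (be v + 0) %% p)%N)
           (be_t : forall v, (be (t * v)%g = (be v + 1) %% p)%N).

Fixpoint power_t j : cochain F T j.*2 :=
  if j is j'.+1 then cup (carry_cochain be) (power_t j') else [ffun=> 1].

Fixpoint monomial i j : cochain F T (i + j).*2 :=
  if i is i'.+1 then cup (carry_cochain al) (monomial i' j) else power_t j.

Lemma cobd_cup_carry ga n (f : cochain F T n) : (forall v, ga v < p)%N -> cobd f = 0 ->
  cobd (cup (carry_cochain ga) f) = 0.
Proof.
move=> ga_lt f0; apply/ffunP => u; rewrite cobd_cup f0 carry_cocycle //.
by rewrite !ffunE mul0r !mulr0 addr0.
Qed.

Lemma cobd_monomial i j : cobd (monomial i j) = 0.
Proof.
elim: i => [|i IH] /=; last exact: cobd_cup_carry.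
elim: j => [|j IH] /=; last exact: cobd_cup_carry.
by apply/ffunP => u; rewrite !ffunE !big_ord_recl big_ord0 !ffunE /= addr0 !mulr1 addrN.
Qed.

Lemma translate_monomial x c c' i j :
    (forall v, al (x * v)%g = (al v + c) %% p)%N ->
    (forall v, be (x * v)%g = (be v + c') %% p)%N ->
  translate x (monomial i j) = monomial i j.
Proof.
move=> al_x be_x; elim: i => [|i IH] /=; last first.
  transitivity (cup (translate x (carry_cochain al)) (translate x (monomial i j))).
    exact: (translate_cup x (carry_cochain al) (monomial i j)).
  by rewrite IH (translate_carry al_lt al_x).
elim: j => [|j IH] /=; last first.
  transitivity (cup (translate x (carry_cochain be)) (translate x (power_t j))).
    exact: (translate_cup x (carry_cochain be) (power_t j)).
  by rewrite IH (translate_carry be_lt be_x).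
by apply/ffunP => u; rewrite !ffunE.
Qed.

Let al_si i v : (al (s ^+ i * v)%g = (al v + i) %% p)%N.
Proof.
elim: i => [|i IH]; first by rewrite mul1g addn0 modn_small.
by rewrite expgS -mulgA al_s IH modnDml addn1 addnS.
Qed.
Let be_ti i v : (be (t ^+ i * v)%g = (be v + i) %% p)%N.
Proof.
elim: i => [|i IH]; first by rewrite mul1g addn0 modn_small.
by rewrite expgS -mulgA be_t IH modnDml addn1 addnS.
Qed.
Let al_ti i v : al (t ^+ i * v)%g = al v.
Proof.
by elim: i => [|i IH]; rewrite ?mul1g // expgS -mulgA al_t IH addn0 modn_small.
Qed.
Let be_si i v : be (s ^+ i * v)%g = be v.
Proof.
by elim: i => [|i IH]; rewrite ?mul1g // expgS -mulgA be_s IH addn0 modn_small.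
Qed.

(** Adding 1 to [i < p] produces a carry only for [i = p - 1]. *)
Lemma sum_carry ga x : (forall v, ga v < p)%N ->
    (forall i v, (ga (x ^+ i * v)%g = (ga v + i) %% p)%N) ->
  \sum_(i < p) ((carry ga 1%g (x ^+ i)%g (x ^+ i.+1)%g)%:R : F) = 1.
Proof.
move=> ga_lt ga_x; have gaE i v : (digit_diff ga v (x ^+ i * v)%g = i %% p)%N.
  rewrite /digit_diff ga_x modnDml addnAC subnKC; last exact: ltnW.
  by rewrite addnC modnDr.
have carryE i : carry ga 1%g (x ^+ i)%g (x ^+ i.+1)%g = ((i %% p + 1) %/ p)%N.
  rewrite /carry -{1}[(x ^+ i)%g]mulg1 gaE expgS -{2}[x]expg1 gaE.
  by rewrite [(1 %% p)%N]modn_small.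
have p_pred := ltn_predL p; rewrite p_gt0 in p_pred.
rewrite (bigD1 (Ordinal p_pred)) //= big1 => [|i]; last first.
  rewrite -val_eqE /= carryE => i_neq; rewrite modn_small // divn_small //.
  by have := ltn_ord i; lia.
by rewrite carryE modn_small // addn1 prednK // divnn p_gt0 addr0.
Qed.

Lemma shift_monomial x c c' i j l :
    (forall v, al (x * v)%g = (al v + c) %% p)%N ->
    (forall v, be (x * v)%g = (be v + c') %% p)%N -> size l = (i + j).*2.+1 ->
  shift x (seq_cochain (monomial i j)) l = seq_cochain (monomial i j) l.
Proof.
by move=> al_x be_x sl; rewrite -seq_cochain_shift // (translate_monomial _ _ al_x be_x).
Qed.

(** The monomials form the basis dual to the generators of even bidegree: the
    factors are removed one by one with [pairing_cup_s] and [pairing_cup_t]. *)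
Lemma pairing_monomial a b i j : (a + b = i + j)%N ->
  pairing p s t a.*2 b.*2 (seq_cochain (monomial i j)) = (a == i)%:R.
Proof.
pose ya x0 x1 x2 : F := (carry al x0 x1 x2)%:R; pose yb x0 x1 x2 : F := (carry be x0 x1 x2)%:R.
have ya_t m x : ya 1%g (t ^+ m)%g x = 0.
  by rewrite /ya carry_eq0l // -[(t ^+ m)%g]mulg1 al_ti.
have yb_s m x : yb 1%g (s ^+ m)%g x = 0.
  by rewrite /yb carry_eq0l // -[(s ^+ m)%g]mulg1 be_si.
have ya_st m m' : ya 1%g (s ^+ m)%g (s ^+ m * t ^+ m')%g = 0.
  by rewrite /ya carry_eq0r // (commuteX2 m m' cst) al_ti.
have yb_ts m m' : yb 1%g (t ^+ m)%g (t ^+ m * s ^+ m')%g = 0.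
  by rewrite /yb carry_eq0r // -(commuteX2 m' m cst) be_si.
have al_t0 m v : (al (t ^+ m * v)%g = (al v + 0) %% p)%N by rewrite al_ti addn0 modn_small.
have be_s0 m v : (be (s ^+ m * v)%g = (be v + 0) %% p)%N by rewrite be_si addn0 modn_small.
elim: i a b => [|i IH] a b ab.
  elim: j a b ab => [|j IH] a b ab.
    have [-> ->] : a = 0%N /\ b = 0%N by lia.
    by rewrite pairingE /= /seq_cochain ffunE.
  have stepE x0 x1 x2 w : seq_cochain (power_t j.+1) [:: x0, x1, x2 & w] =
      yb x0 x1 x2 * seq_cochain (power_t j) (x2 :: w).
    exact: seq_cochain_cup_carry.
  rewrite [monomial 0 j.+1]/(power_t j.+1); move: (seq_cochain (power_t j.+1)) stepE => g gE.
  case: b ab => [|b] ab.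
    have -> : a = j.+1 by lia.
    by rewrite doubleS; apply: pairing_cup_t0 yb_s; rewrite ?oddS ?odd_double.
  rewrite doubleS -(IH a b); last by lia.
  apply: pairing_cup_t yb_s yb_ts _; rewrite ?odd_double //.
    move=> m w sw; apply: (shift_monomial (i := 0) (al_t0 m) (be_ti m)).
    by rewrite sw -doubleD; congr _.+1; lia.
  exact: sum_carry.
have stepE x0 x1 x2 w : seq_cochain (monomial i.+1 j) [:: x0, x1, x2 & w] =
    ya x0 x1 x2 * seq_cochain (monomial i j) (x2 :: w).
  exact: seq_cochain_cup_carry.
move: (seq_cochain (monomial i.+1 j)) stepE => g gE.
case: a ab => [|a] ab.
  have -> : b = (i + j).+1 by lia.
  by rewrite doubleS; apply: pairing_cup_s0 ya_t; rewrite ?oddS ?odd_double.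
rewrite doubleS eqSS -(IH a b); last by lia.
apply: pairing_cup_s ya_t ya_st _; rewrite ?odd_double //; last exact: sum_carry.
move=> m w sw; apply: (shift_monomial (al_si m) (be_s0 m)).
by rewrite sw -doubleD; congr _.+1; lia.
Qed.

End Monomials.

End CarryClass.

End SeqCochains.

(** * Bounds for the cohomology of subgroups *)
Section HalfExact.

Variables (K : fieldType) (U V W : vectType K).
Variables (d : 'Hom(U, V)) (d' : 'Hom(V, W)).
Variables (phiU : 'Hom(U, U)) (phiV : 'Hom(V, V)) (phiW : 'Hom(W, W)).
Hypotheses (comm_d : forall u, phiV (d u) = d (phiU u)).
Hypotheses (comm_d' : forall v, phiW (d' v) = d' (phiV v)).

(** The inequality [h(B) <= h(A) + h(C)] in the cohomology sequence of
    [0 -> A -> B -> C -> 0], where the map from [B] to [C] is [phi]. By the rank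
    formula for [phi], the cocycles of [B] have at most, and the coboundaries of
    [B] at least, the sum of the dimensions for [A] and [C]. *)
Lemma half_exact_dim (A B C : {vspace U}) (A' B' C' : {vspace V}) mA mC :
    (A <= B :&: lker phiU)%VS -> (phiU @: B = C)%VS ->
    (B' :&: lker phiV <= A')%VS -> (phiV @: B' <= C')%VS ->
    (\dim (A' :&: lker d') <= \dim (d @: A) + mA)%N ->
    (\dim (C' :&: lker d') <= \dim (d @: C) + mC)%N ->
  (\dim (B' :&: lker d') <= \dim (d @: B) + (mA + mC))%N.
Proof.
move=> sAB BC sBA' sBC' hA hC.
have dimB' : (\dim (B' :&: lker d') <= \dim (A' :&: lker d') + \dim (C' :&: lker d'))%N.
  rewrite -(limg_ker_dim phiV (B' :&: lker d')) leq_add // dimvS //.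
    apply/subvP => v /memv_capP[/memv_capP[Bv dv] kv].
    by rewrite memv_cap dv andbT (subvP sBA') // memv_cap Bv.
  rewrite subv_cap; apply/andP; split.
    by apply: subv_trans (limgS _ (capvSl _ _)) sBC'.
  apply/subvP => _ /memv_imgP[u /memv_capP[_ du] ->]; rewrite memv_ker in du.
  by rewrite memv_ker -comm_d' (eqP du) linear0.
have dimB : (\dim (d @: A) + \dim (d @: C) <= \dim (d @: B))%N.
  rewrite -(limg_ker_dim phiV (d @: B)) leq_add // dimvS //.
    rewrite subv_cap; apply/andP; split; first by rewrite limgS // (subv_trans sAB) ?capvSl.
    apply/subvP => _ /memv_imgP[u Au ->]; rewrite memv_ker comm_d.
    have /memv_capP[_] := subvP sAB u Au; rewrite memv_ker => /eqP->.
    by rewrite linear0.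
  rewrite -BC -!limg_comp (_ : (phiV \o d = d \o phiU)%VF) //.
  by apply/lfunP => u; rewrite !comp_lfunE comm_d.
by lia.
Qed.

End HalfExact.

Section SubgroupInvariants.

Variables (F : fieldType) (T : finGroupType).
Implicit Types (K : {group T}) (x : T).

Definition inv_cochains (K : {set T}) n : {vspace cochain F T n} :=
  (\bigcap_(x in K) fixedSpace (linfun (@translate F T n x)))%VS.

Lemma inv_cochainsP (K : {set T}) n (f : cochain F T n) :
  reflect (forall x, x \in K -> translate x f = f) (f \in inv_cochains K n).
Proof.
apply: (iffP idP) => [finv x Kx | finv].
  have: f \in fixedSpace (linfun (@translate F T n x)).
    by apply: subvP finv; apply: bigcapv_inf (subvv _).
  by move/fixedSpaceP; rewrite lfunE.
rewrite memvE; apply/subv_bigcapP => x Kx; rewrite -memvE.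
by apply/fixedSpaceP; rewrite lfunE; apply: finv.
Qed.

Definition cobdL n : 'Hom(cochain F T n, cochain F T n.+1) := linfun (@cobd F T n).

(** The cohomology of the complex [V] in degree [n + 1] has dimension at most
    [m]. *)
Definition cohomology_le (V : forall n, {vspace cochain F T n}) n m :=
  (\dim (V n.+1 :&: lker (cobdL n.+1)) <= \dim (cobdL n @: V n) + m)%N.

Lemma eq_cohomology_le V V' n m : (forall i, V i = V' i) ->
  cohomology_le V n m -> cohomology_le V' n m.
Proof. by move=> eqV; rewrite /cohomology_le !eqV. Qed.

Lemma translate_comp n x y (f : cochain F T n) :
  translate x (translate y f) = translate (y * x)%g f.
Proof.
apply/ffunP => s; rewrite !ffunE; congr (f _).
by apply/ffunP => i; rewrite !ffunE mulgA.
Qed.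

Lemma translate1 n (f : cochain F T n) : translate 1%g f = f.
Proof.
apply/ffunP => s; rewrite !ffunE; congr (f _).
by apply/ffunP => i; rewrite !ffunE mul1g.
Qed.

Lemma inv_cochains_gen (A : {set T}) n (f : cochain F T n) :
  (forall x, x \in A -> translate x f = f) -> f \in inv_cochains <<A>> n.
Proof.
move=> fA; pose S := [set y | translate y f == f].
have groupS : group_set S.
  apply/group_setP; split=> [|y z]; first by rewrite inE translate1.
  by rewrite !inE -translate_comp => /eqP-> /eqP->.
have sAS : (<<A>> \subset Group groupS)%g.
  by rewrite gen_subG; apply/subsetP => x Ax; rewrite inE fA.
by apply/inv_cochainsP => y /(subsetP sAS); rewrite inE => /eqP.
Qed.

Section Step.

Variables (p : nat) (K : {group T}) (x : T).
Hypotheses (p_pr : prime p) (charF : p%:R = 0 :> F).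
Hypotheses (Nx : x \in 'N(K)%g) (Kxp : (x ^+ p \in K)%g) (Kx : x \notin K).

Definition diff n (f : cochain F T n) : cochain F T n := translate x f - f.

Fact diff_linear n : linear (@diff n).
Proof.
by move=> a f h; rewrite /diff linearP /= scalerBr opprD addrACA.
Qed.
HB.instance Definition _ n :=
  GRing.isLinear.Build F (cochain F T n) (cochain F T n) _ (@diff n) (@diff_linear n).

Lemma exp_in_K m : (x ^+ m \in K)%g = (p %| m)%N.
Proof.
have ox : #[coset K x]%g = p.
  apply: nt_prime_order; rewrite // -?morphX //.
    by rewrite /= coset_id.
  by apply: contra Kx => /eqP; apply: coset_idr.
rewrite -ox order_dvdn -morphX //=; apply/idP/eqP => [|/coset_idr]; first exact: coset_id.
by apply; rewrite groupX.
Qed.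

(** The functions on [T] that are invariant under [K] form a free module over the
    group of order [p] generated by [x] modulo [K]; [e] is the indicator function
    of a fundamental domain, made of one coset of [K] in each coset of [<K, x>]. *)
Lemma slice : exists e : T -> F,
  (forall k y, k \in K -> e (k * y)%g = e y) /\
  (forall y, \sum_(i < p) e (x ^+ i * y)%g = 1).
Proof.
pose K' := (K <*> <[x]>)%G; pose r y := repr (K' :* y).
have sKK' : (K \subset K')%g by apply: joing_subl.
have K'x : x \in K' by rewrite (subsetP (joing_subr _ _)) // cycle_id.
have r_eq k y : k \in K' -> r (k * y)%g = r y.
  by move=> K'k; rewrite /r rcosetM rcoset_id.
have rK' y : (y * (r y)^-1 \in K')%g.
  by rewrite -mem_rcoset rcoset_sym; apply: mem_repr_rcoset.
exists (fun y => ((y * (r y)^-1)%g \in K)%:R); split=> [k y Kk|y].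
  by rewrite r_eq ?(subsetP sKK') // -mulgA groupMl.
have : (y * (r y)^-1 \in <[x]> * K)%g.
  by have := rK' y; rewrite /= joingC norm_joinEl // cycle_subG.
case/mulsgP=> _ k /cycleP[j ->] Kk yE.
have memE i : (x ^+ i * y * (r (x ^+ i * y))^-1 \in K)%g = (p %| i + j)%N.
  by rewrite r_eq ?groupX // -mulgA yE mulgA -expgD groupMr // exp_in_K.
have p_gt0 := prime_gt0 p_pr.
have lt_i0 : ((p - j %% p) %% p < p)%N by rewrite ltn_mod.
rewrite (bigD1 (Ordinal lt_i0)) //= big1 => [|i]; rewrite memE /=.
  rewrite addr0 /dvdn modnDml -modnDmr subnK ?modnn //.
  by rewrite ltnW // ltn_mod.
rewrite -val_eqE /=; case: (boolP (p %| i + j)%N) => // p_dvd /eqP[].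
have : (i + j %% p = p - j %% p + j %% p %[mod p])%N.
  by rewrite modnDmr (eqP p_dvd) subnK ?modnn // ltnW // ltn_mod.
by move/eqP; rewrite eqn_modDr (modn_small (ltn_ord i)) => /eqP->.
Qed.

Lemma iter_diff n m (f : cochain F T n) :
  iter m (@diff n) f = \sum_(i < m.+1) (('X - 1) ^+ m : {poly F})`_i *: translate (x ^+ i)%g f.
Proof.
elim: m => [|m IH]; first by rewrite big_ord1 expr0 coef1 scale1r translate1.
rewrite iterS IH {1}/diff linear_sum /=.
have coefE i : (('X - 1) ^+ m.+1 : {poly F})`_i =
   (if i is i'.+1 then (('X - 1) ^+ m : {poly F})`_i' else 0) - (('X - 1) ^+ m : {poly F})`_i.
  by rewrite exprSr mulrBr mulr1 coefB coefMX; case: i.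
under [in RHS]eq_bigr do rewrite coefE scalerBl.
rewrite sumrB; congr (_ - _).
  rewrite [in RHS]big_ord_recl scale0r add0r; apply: eq_bigr => i _.
  by rewrite linearZ /= translate_comp expgSr.
rewrite [in RHS]big_ord_recr /= [X in _ + X *: _]nth_default ?scale0r ?addr0 //.
by rewrite -[1]/(1%:P) size_exp_XsubC.
Qed.

(** In characteristic [p], [(X - 1) ^ (p - 1)] is [(X ^ p - 1) / (X - 1)]. *)
Lemma coef_norm i : (i < p)%N -> (('X - 1) ^+ p.-1 : {poly F})`_i = 1.
Proof.
move=> lt_ip; have p_gt0 := prime_gt0 p_pr.
have charP : p \in [pchar {poly F}].
  by rewrite inE p_pr /= -polyC_natr charF.
suff -> : ('X - 1) ^+ p.-1 = \poly_(j < p) 1 :> {poly F} by rewrite coef_poly lt_ip.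
have X1_neq0 : 'X - 1 != 0 :> {poly F} by rewrite -[1]/(1%:P) polyXsubC_eq0.
apply: (mulfI X1_neq0); rewrite -exprS prednK // poly_def.
under [in RHS]eq_bigr do rewrite scale1r.
rewrite -subrX1 -!(pFrobenius_autE charP) rmorphB rmorph1 //.
Qed.

(** The norm of [f] is [(x - 1) ^ (p - 1) f = 0]. With [e] as in [slice], a
    primitive of [f] is minus the sum over [i < p] of the products of [x ^ i e] by
    [f + x f + ... + x ^ (i - 1) f]: applying [x] replaces the term of index [i]
    by that of index [i + 1] minus [f] times a translate of [e], the translates of
    [e] add up to 1, and the terms of index 0 and [p] vanish. *)
Lemma diff_onto n j (f : cochain F T n) : (j < p)%N ->
    f \in inv_cochains K n -> iter j (@diff n) f = 0 ->
  exists2 g, g \in inv_cochains K n & diff g = f.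
Proof.
move=> lt_jp /inv_cochainsP fK fj.
have norm0 s : \sum_(i < p) translate (x ^+ i)%g f s = 0.
  have : iter p.-1 (@diff n) f = 0.
    have -> : p.-1 = (p.-1 - j + j)%N by rewrite subnK // -ltnS prednK ?prime_gt0.
    by rewrite iterD fj; elim: (p.-1 - j)%N => //= m ->; rewrite linear0.
  rewrite iter_diff prednK ?prime_gt0 // => /ffunP/(_ s); rewrite sum_ffunE [RHS]ffunE; apply: etrans.
  by apply: eq_bigr => i _; rewrite coef_norm // scale1r.
have [e [eK e1]] := slice.
pose A i (s : simplex T n) : F := \sum_(k < i) translate (x ^+ k)%g f s.
pose g : cochain F T n := [ffun s : simplex T n => - \sum_(i < p) e (x ^+ i * s ord0)%g * A i s].
have moveK y m k : k \in K -> exists2 k', k' \in K & (x ^+ m * (k * y) = k' * (x ^+ m * y))%g.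
  move=> Kk; exists (k ^ (x ^- m))%g; first by rewrite memJ_norm // groupV groupX.
  by rewrite conjgE invgK !mulgA mulgKV.
exists g.
  apply/inv_cochainsP => k Kk; apply/ffunP => s; rewrite !ffunE; congr (- _).
  apply: eq_bigr => i _; congr (_ * _).
    rewrite ?ffunE; by have [k' Kk' ->] := moveK (s ord0) i k Kk; rewrite eK.
  apply: eq_bigr => m _; have Kkm : (k ^ (x ^- m) \in K)%g by rewrite memJ_norm // groupV groupX.
  transitivity (translate k (translate (x ^+ m)%g f) s); first by rewrite [RHS]ffunE.
  rewrite translate_comp -[in RHS](fK _ Kkm) translate_comp; congr (translate _ f s).
  by rewrite conjgE invgK !mulgA mulgKV.
apply/ffunP => s; rewrite /diff !ffunE.
pose E i := e (x ^+ i * s ord0)%g; pose B i := E i * A i s.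
have AS i : A i [ffun t => (x * s t)%g] = A i.+1 s - f s.
  rewrite /A big_ord_recl expg0 translate1 [f s + _]addrC addrK; apply: eq_bigr => m _.
  by rewrite expgSr -translate_comp [RHS]ffunE.
have -> : \sum_(i < p) e (x ^+ i * (x * s ord0))%g * A i [ffun t => (x * s t)%g] =
    \sum_(i < p) B i.+1 - f s.
  transitivity (\sum_(i < p) (B i.+1 - f s * e (x ^+ i * (x * s ord0))%g)).
    by apply: eq_bigr => i _; rewrite AS /B /E expgSr -mulgA mulrBr [f s * _]mulrC.
  by rewrite sumrB -mulr_sumr e1 mulr1.
have -> : \sum_(i < p) B i.+1 = \sum_(i < p) B i.
  apply/eqP; rewrite -subr_eq0 -sumrB -(big_mkord xpredT (fun i => B i.+1 - B i)) telescope_sumr //.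
  by rewrite /B /A norm0 big_ord0 !mulr0 subrr.
by rewrite opprB addrK.
Qed.

Definition diffL n : 'End(cochain F T n) := linfun (@diff n).

(** The kernels of [(x - 1) ^ j] on the cochains invariant under [K], from the
    cochains invariant under [<K, x>], for [j = 1], to all of them, for [j = p]. *)
Fixpoint filtration j n : {vspace cochain F T n} :=
  if j is j'.+1 then (inv_cochains K n :&: (diffL n @^-1: filtration j' n))%VS else 0%VS.

Lemma diff_inv n (f : cochain F T n) :
  f \in inv_cochains K n -> diff f \in inv_cochains K n.
Proof.
move=> fK; rewrite rpredB //; apply/inv_cochainsP => k Kk.
have Kkx : (k ^ (x^-1) \in K)%g by rewrite memJ_norm // groupV.
rewrite translate_comp; have /inv_cochainsP/(_ _ Kkx) {2}<- := fK.
by rewrite translate_comp conjgE invgK !mulgA mulgKV.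
Qed.

Lemma filtrationP j n (f : cochain F T n) :
  reflect (f \in inv_cochains K n /\ iter j (@diff n) f = 0) (f \in filtration j n).
Proof.
elim: j f => [|j IH] f /=.
  by rewrite memv0; apply: (iffP eqP) => [->|[]] //; rewrite mem0v.
rewrite memv_cap -memv_preim lfunE /=; apply: (iffP andP).
  by case=> fK /IH[_]; rewrite -iterSr.
by case=> fK fj; split=> //; apply/IH; rewrite -iterSr diff_inv.
Qed.

Arguments filtration : simpl never.

Lemma diff_cobd n (f : cochain F T n) : diff (cobd f) = cobd (diff f).
Proof. by rewrite /diff -cobd_translate linearB. Qed.

(** By [diff_onto], [x - 1] maps each step of the filtration onto the previous
    one, with kernel [filtration 1]. *)
Lemma filtration_le j n c : (j <= p)%N -> cohomology_le (filtration 1) n c ->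
  cohomology_le (filtration j) n (j * c).
Proof.
move=> le_jp le1; elim: j le_jp => [|j IH] lt_jp.
  by rewrite /cohomology_le /= cap0v dimv0.
rewrite mulSn; have {IH}lej := IH (ltnW lt_jp).
apply: (@half_exact_dim _ _ _ _ (cobdL n) (cobdL n.+1) (diffL n) (diffL n.+1) (diffL n.+2)
  _ _ (filtration 1 n) (filtration j.+1 n) (filtration j n)
  (filtration 1 n.+1) (filtration j.+1 n.+1) (filtration j n.+1)) => //.
- by move=> f; rewrite !lfunE; apply: diff_cobd.
- by move=> f; rewrite !lfunE; apply: diff_cobd.
- apply/subvP => f /filtrationP[fK /= f1]; rewrite memv_cap; apply/andP; split.
    apply/(filtrationP j.+1); rewrite fK iterSr f1; split=> //.
    by elim: (j) => //= m ->; rewrite linear0.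
  by rewrite memv_ker lfunE; apply/eqP.
- apply/eqP; rewrite eqEsubv; apply/andP; split; apply/subvP => f.
    by case/memv_imgP=> g /filtrationP[gK gj] ->; apply/filtrationP; rewrite lfunE -iterSr diff_inv.
  case/filtrationP=> fK fj; have [g gK gf] := diff_onto lt_jp fK fj.
  by apply/memv_imgP; exists g; rewrite ?lfunE //; apply/filtrationP; rewrite iterSr gf.
- apply/subvP => f; rewrite memv_cap memv_ker lfunE => /andP[/filtrationP[fK _] /eqP f1].
  by apply/filtrationP.
apply/subvP => _ /memv_imgP[g /filtrationP[gK gj] ->]; apply/filtrationP.
by rewrite lfunE -iterSr diff_inv.
Qed.

Lemma filtration1 n : filtration 1 n = inv_cochains (K <*> <[x]>) n.
Proof.
apply/eqP; rewrite eqEsubv; apply/andP; split; apply/subvP => f.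
  case/filtrationP=> /inv_cochainsP fK /= /eqP; rewrite subr_eq0 => /eqP fx.
  apply: inv_cochains_gen => y /setUP[/fK //|/cycleP[i ->]].
  elim: i => [|i IH]; first exact: translate1.
  by rewrite expgS -translate_comp fx.
move/inv_cochainsP=> fK'; apply/filtrationP; split.
  by apply/inv_cochainsP => k Kk; apply: fK'; rewrite mem_gen // inE Kk.
by rewrite /= /diff fK' ?subrr // mem_gen // inE cycle_id orbT.
Qed.

Lemma filtration_p n : filtration p n = inv_cochains K n.
Proof.
apply/eqP; rewrite eqEsubv; apply/andP; split; apply/subvP => f; first by case/filtrationP.
move=> fK; apply/filtrationP; split=> //.
rewrite -(prednK (prime_gt0 p_pr)) iterS iter_diff prednK ?prime_gt0 //.
under eq_bigr do rewrite coef_norm // scale1r.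
rewrite /diff linear_sum -sumrB.
under eq_bigr do rewrite /= translate_comp -expgSr.
rewrite -(big_mkord xpredT (fun i => translate (x ^+ i.+1)%g f - translate (x ^+ i)%g f)).
rewrite telescope_sumr // expg0 translate1.
by have /inv_cochainsP-> := fK; rewrite ?subrr.
Qed.

Lemma cohomology_le_step c : (forall n, cohomology_le (inv_cochains (K <*> <[x]>)) n c) ->
  forall n, cohomology_le (inv_cochains K) n (p * c).
Proof.
move=> le1 n; apply: (eq_cohomology_le filtration_p); apply: filtration_le => //.
by apply: eq_cohomology_le (le1 n) => i; rewrite filtration1.
Qed.

End Step.

End SubgroupInvariants.

(** * Unboundedness in rank 2 *)
Section PGroupCohomology.

Variables (F : fieldType) (T : finGroupType) (p : nat).
Hypotheses (p_pr : prime p) (charF : p%:R = 0 :> F).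

(** In a [p]-group a proper subgroup is normal of index [p] in some larger
    subgroup, to which [cohomology_le_step] applies. *)
Lemma cohomology_le_subgroup c (K : {group T}) : (p.-group [set: T])%g ->
    (forall n, cohomology_le (inv_cochains F [set: T]) n c) ->
  exists c', forall n, cohomology_le (inv_cochains F K) n c'.
Proof.
move=> pT leT; elim: {K}_.+1 {-2}K (ltnSn (#|[set: T]| - #|K|)) => // m IH K le_m.
have [->|ltKT] := eqVneq K [set: T]%G; first by exists c.
have properKT : (K \proper [set: T])%g.
  by rewrite properT; apply: contraNneq ltKT => KT; apply/eqP/val_inj.
have := nilpotent_proper_norm (pgroup_nil pT) properKT; rewrite setTI => ltKN.
have ntQ : ('N(K) / K != 1)%g by rewrite -subG1 quotient_sub1 // proper_subn.
have pQ : (p.-group ('N(K) / K))%g by rewrite quotient_pgroup // (pgroupS (subsetT _) pT).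
have [_ p_dvd _] := pgroup_pdiv pQ ntQ.
have [xb /morphimP[x Nx _ xbE] oxb] := Cauchy p_pr p_dvd.
have Kxp : (x ^+ p \in K)%g.
  by apply: coset_idr; rewrite ?groupX // morphX //= -xbE -oxb expg_order.
have Kx : x \notin K.
  by apply: contraTN (prime_gt1 p_pr) => Kx; rewrite -oxb xbE /= coset_id ?order1.
have [|c' le'] := IH (K <*> <[x]>)%G.
  have ltK : (#|K| < #|K <*> <[x]>|)%N.
    apply: proper_card; rewrite properE joing_subl /=.
    by apply: contra Kx => /subsetP; apply; rewrite mem_gen // inE cycle_id orbT.
  have lt_sub (a k k' i : nat) : (a - k < i.+1 -> k < k' -> k' <= a -> a - k' < i)%N by lia.
  exact: lt_sub le_m ltK (subset_leq_card (subsetT _)).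
exists (p * c')%N; exact: (cohomology_le_step p_pr charF Nx Kxp Kx le').
Qed.

(** The digits of [y] are the exponents of [s] and [t] that lead to [y] from the
    representative of its right coset of [<s, t>]. *)
Lemma coordinates (s t : T) : commute s t -> #[s]%g = p -> #[t]%g = p -> t \notin <[s]>%g ->
  exists al be : T -> nat,
  [/\ (forall v, al v < p)%N /\ (forall v, be v < p)%N,
      forall v, (al (s * v)%g = (al v + 1) %% p)%N,
      forall v, (al (t * v)%g = (al v + 0) %% p)%N,
      forall v, (be (s * v)%g = (be v + 0) %% p)%N
    & forall v, (be (t * v)%g = (be v + 1) %% p)%N].
Proof.
move=> cst os ot nst; have p_gt0 := prime_gt0 p_pr.
pose r y := repr ((<[s]> <*> <[t]>)%G :* y)%g.
have cTS : (<[t]> \subset 'C(<[s]>))%g by rewrite cent_cycle cycle_subG; apply/cent1P.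
have rE k y : k \in (<[s]> <*> <[t]>)%g -> r (k * y)%g = r y.
  by move=> Ek; rewrite /r rcosetM rcoset_id.
have ex y : exists ab : 'I_p * 'I_p, y = (s ^+ ab.1 * t ^+ ab.2 * r y)%g.
  have : (y * (r y)^-1 \in (<[s]> <*> <[t]>)%G)%g.
    by rewrite -mem_rcoset rcoset_sym; apply: mem_repr_rcoset.
  rewrite /= cent_joinEr // => /mulsgP[_ _ /cycleP[i ->] /cycleP[j ->] yE].
  have lt m : (m %% p < p)%N by rewrite ltn_mod.
  exists (Ordinal (lt i), Ordinal (lt j)) => /=.
  by rewrite -{1}os -{1}ot !expg_mod_order -yE mulgKV.
have [h hE] := fin_all_exists ex.
have tiST : (<[s]> :&: <[t]> = 1)%g.
  by rewrite setIC; apply: prime_TIg; rewrite -?orderE ?ot // cycle_subG.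
have uniq i j i' j' : (s ^+ i * t ^+ j = s ^+ i' * t ^+ j')%g ->
    (i = i' %[mod p])%N /\ (j = j' %[mod p])%N.
  move=> eqst; have eqX : (s ^- i' * s ^+ i = t ^+ j' * t ^- j)%g.
    by apply: (mulIg (t ^+ j)%g); rewrite mulgKV -mulgA eqst mulKg.
  have X1 : (s ^- i' * s ^+ i = 1)%g.
    apply/set1gP; rewrite -tiST inE {2}eqX.
    by rewrite !groupM ?groupV ?mem_cycle.
  have eqs : (s ^+ i = s ^+ i')%g by apply: (mulgI (s ^- i')%g); rewrite X1 mulVg.
  have eqt : (t ^+ j = t ^+ j')%g by apply: (mulgI (s ^+ i)%g); rewrite eqst eqs.
  split; apply/eqP; first by rewrite -os -eq_expg_mod_order eqs.
  by rewrite -ot -eq_expg_mod_order eqt.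
have Es : s \in (<[s]> <*> <[t]>)%g by rewrite mem_gen // inE cycle_id.
have Et : t \in (<[s]> <*> <[t]>)%g by rewrite mem_gen // inE cycle_id orbT.
have shift_s v : (s ^+ (h (s * v)%g).1 * t ^+ (h (s * v)%g).2 =
    s ^+ ((h v).1 + 1) * t ^+ (h v).2)%g.
  apply: (mulIg (r v)); rewrite -{1}(rE s v Es) -hE {1}(hE v) addn1 expgS.
  by rewrite -!mulgA.
have shift_t v : (s ^+ (h (t * v)%g).1 * t ^+ (h (t * v)%g).2 =
    s ^+ (h v).1 * t ^+ ((h v).2 + 1))%g.
  apply: (mulIg (r v)); rewrite -{1}(rE t v Et) -hE {1}(hE v) addn1 expgS.
  by rewrite !mulgA (commuteX (h v).1 (commute_sym cst)).
exists (fun y => (h y).1), (fun y => (h y).2).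
have small (i : 'I_p) : (i %% p)%N = i by rewrite modn_small.
split; first by split=> v; apply: ltn_ord.
- by move=> v /=; have [<- _] := uniq _ _ _ _ (shift_s v); rewrite small.
- by move=> v /=; have [eqm _] := uniq _ _ _ _ (shift_t v); rewrite addn0 -eqm small.
- by move=> v /=; have [_ eqm] := uniq _ _ _ _ (shift_s v); rewrite addn0 -eqm small.
- by move=> v /=; have [_ <-] := uniq _ _ _ _ (shift_t v); rewrite small.
Qed.

Section RankTwoGrowth.

Variables (s t : T).
Hypotheses (cst : commute s t) (os : #[s]%g = p) (ot : #[t]%g = p) (nst : t \notin <[s]>%g).

Let E := <<[set s; t]>>%g.

Lemma dual_cocycles m : exists f : 'I_m.+1 -> cochain F T m.*2,
  forall i, [/\ f i \in inv_cochains F E m.*2, cobd (f i) = 0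
    & forall a : 'I_m.+1, pairing p s t a.*2 (m - a).*2 (seq_cochain (f i)) = (a == i)%:R].
Proof.
have [al [be [[al_lt be_lt] al_s al_t be_s be_t]]] := coordinates cst os ot nst.
have p_gt0 := prime_gt0 p_pr.
suff ex i : exists g : cochain F T m.*2, [/\ g \in inv_cochains F E m.*2, cobd g = 0
    & forall a : 'I_m.+1, pairing p s t a.*2 (m - a).*2 (seq_cochain g) = (a == i)%:R].
  exact: fin_all_exists ex.
have [j ijE] : exists j, (i + j = m)%N.
  by exists (m - i)%N; rewrite subnKC // -ltnS.
have sp : (s ^+ p = 1)%g by rewrite -os expg_order.
have tp : (t ^+ p = 1)%g by rewrite -ot expg_order.
suff [g [gE g0 gp]] : exists g : cochain F T m.*2, [/\ g \in inv_cochains F E m.*2, cobd g = 0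
   & forall a b, (a + b = m)%N -> pairing p s t a.*2 b.*2 (seq_cochain g) = (a == i)%:R].
  by exists g; split=> // a; rewrite gp // subnKC // -ltnS.
move: (nat_of_ord i) ijE => i' <-; exists (monomial F p al be i' j); split.
- apply: inv_cochains_gen => y /set2P[->|->].
    exact: (translate_monomial F p_gt0 al_lt be_lt _ _ al_s be_s).
  exact: (translate_monomial F p_gt0 al_lt be_lt _ _ al_t be_t).
- exact: cobd_monomial.
by move=> a b ab; apply: pairing_monomial; rewrite ?prime_gt1.
Qed.

(** In degree [2 m], evaluation on the generators [e (2 a) (2 (m - a))] vanishes on
    coboundaries, and maps the [m + 1] monomials of degree [m] to a basis. *)
Lemma rank2_unbounded c : ~ forall n, cohomology_le (inv_cochains F E) n c.
Proof.
pose m := c.+1; move=> /(_ c.*2.+1); rewrite /cohomology_le.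
change ((\dim (inv_cochains F E m.*2 :&: lker (cobdL F T m.*2))%VS <=
  \dim (cobdL F T c.*2.+1 @: inv_cochains F E c.*2.+1)%VS + c)%N -> False).
pose phi (f : cochain F T m.*2) : 'rV[F]_m.+1 :=
  \row_a pairing p s t a.*2 (m - a).*2 (seq_cochain f).
have phi_lin : linear phi.
  move=> a f h; apply/rowP => i; rewrite !mxE -pairing_linear.
  by apply: (eq_pairing p s t (erefl _)) => w _; rewrite /seq_cochain !ffunE.
pose phiLM := GRing.isLinear.Build F _ _ _ phi phi_lin.
pose phiL : {linear cochain F T m.*2 -> 'rV[F]_m.+1} := HB.pack phi phiLM.
pose L := linfun phiL.
set Z := (_ :&: lker _)%VS; set B := (_ @: _)%VS.
have [f fP] := dual_cocycles m.
have fullL : (fullv <= L @: Z)%VS.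
  apply/subvP => v _; apply/memv_imgP; exists (\sum_i v ord0 i *: f i).
    apply: rpred_sum => i _; apply: rpredZ; have [fE f0 _] := fP i.
    by rewrite memv_cap fE memv_ker lfunE /= f0.
  rewrite linear_sum [LHS]row_sum_delta; apply: eq_bigr => i _ /=.
  have -> : L (v ord0 i *: f i) = v ord0 i *: phi (f i) by rewrite linearZ /= lfunE.
  congr (_ *: _); apply/rowP => a; rewrite !mxE.
  by have [_ _ ->] := fP i; rewrite eqxx.
have sBZ : (B <= Z :&: lker L)%VS.
  apply/subvP => _ /memv_imgP[g gE ->]; rewrite lfunE /=; rewrite !memv_cap -andbA.
  have /inv_cochainsP gE' := gE; apply/and3P; split.
  - by apply/inv_cochainsP => x Ex; rewrite -cobd_translate gE'.
  - by rewrite memv_ker lfunE /= cobd_cobd.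
  have [sE tE] : s \in E /\ t \in E by split; apply: mem_gen; rewrite !inE eqxx ?orbT.
  rewrite memv_ker lfunE /=; apply/eqP/rowP => a; rewrite !mxE.
  have sp : (s ^+ p = 1)%g by rewrite -os expg_order.
  have tp : (t ^+ p = 1)%g by rewrite -ot expg_order.
  have degE : (a.*2 + (m - a).*2 = c.*2.+2)%N by rewrite -doubleD subnKC // -ltnS.
  exact: (pairing_coboundary sp tp cst degE charF (gE' s sE) (gE' t tE)).
apply/negP; rewrite -ltnNge -(limg_ker_dim L Z).
have := dimvS fullL; rewrite dimvf /dim /= mul1n => dimL.
by rewrite -addnS leq_add ?dimvS // (leq_trans _ dimL).
Qed.

End RankTwoGrowth.

End PGroupCohomology.

(** * Groups with periodic cohomology *)
Section Periodicity.

Variables (F : fieldType) (T : finGroupType).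

Lemma coboundaries_sub n : (coboundaries F T n <= cocycles F T n)%VS.
Proof.
case: n => [|n]; first exact: sub0v.
apply/subvP => _ /coboundariesSP[h hinv ->]; apply/cocyclesP; split=> [x|].
  by rewrite -cobd_translate hinv.
exact: cobd_cobd.
Qed.

(** If the cup product with [eta] is onto, then the cocycles of degree [i + d] are
    spanned by the coboundaries and by the products with [eta] of a complement of
    the coboundaries in degree [i]. *)
Lemma cup_surjective_le i d (eta : cohomology F T d) m :
    (forall z : cohomology F T (i + d), exists x, cup_class x eta = z) ->
    (\dim (cocycles F T i) <= \dim (coboundaries F T i) + m)%N ->
  (\dim (cocycles F T (i + d)) <= \dim (coboundaries F T (i + d)) + m)%N.
Proof.
move=> onto le_i; pose e := generic_quotient.repr eta.
pose cupe (f : cochain F T i) : cochain F T (i + d) := cup f (vsval e).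
have cupe_lin : linear cupe.
  by move=> a f h; apply/ffunP => s; rewrite !ffunE mulrDl -scalerAl.
pose cupeLM := GRing.isLinear.Build F _ _ _ cupe cupe_lin.
pose cupeL : {linear cochain F T i -> cochain F T (i + d)} := HB.pack cupe cupeLM.
pose W := (cocycles F T i :\: coboundaries F T i)%VS.
have dimW : (\dim W <= m)%N.
  rewrite -(leq_add2l (\dim (cocycles F T i :&: coboundaries F T i))) dimv_cap_compl.
  by rewrite (capv_idPr (coboundaries_sub i)).
have sub : (cocycles F T (i + d) <= linfun cupeL @: W + coboundaries F T (i + d))%VS.
  apply/subvP => z Zz; have [x xE] := onto (cohomology_class (Subvs Zz)).
  have Zdiff : z - cup (vsval (generic_quotient.repr x)) (vsval e) \in coboundaries F T (i + d).
    move/eqP: xE; rewrite -{1}[x]reprK -{1}[eta]reprK eq_sym.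
    rewrite -!/(cohomology_class _) cup_class_of cohomology_class_eq //.
  have : vsval (generic_quotient.repr x) \in (W + cocycles F T i :&: coboundaries F T i)%VS.
    by rewrite addv_diff_cap subvsP.
  case/memv_addP=> w Ww [b /memv_capP[_ Bb] abE].
  have uE : cup (vsval (generic_quotient.repr x)) (vsval e) = linfun cupeL w + cup b (vsval e).
    by rewrite abE lfunE; apply: (linearD cupeL).
  move: (cup (vsval _) _) uE Zdiff => u uE Zdiff.
  rewrite -[z](subrK u) addrC {1}uE -addrA memv_add ?memv_img // rpredD //.
  by apply: cup_coboundaryl => //; apply: subvsP.
apply: leq_trans (dimvS sub) _; apply: leq_trans (dimv_add_leqif _ _) _.
rewrite addnC leq_add2l; apply: leq_trans dimW.
by rewrite -(limg_ker_dim (linfun cupeL) W) leq_addl.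
Qed.

(** Periodicity carries a bound for the degrees at most [d] to all degrees. *)
Lemma periodic_bounded d (eta : cohomology F T d) : (0 < d)%N ->
    (forall i, (0 < i)%N -> bijective (fun x : cohomology F T i => cup_class x eta)) ->
  exists c, forall n, cohomology_le (inv_cochains F [set: T]) n c.
Proof.
move=> d_gt0 per; exists (\sum_(i < d.+1) \dim (cocycles F T i))%N; set c := (\sum_(i < _) _)%N.
have le n : (0 < n)%N -> (\dim (cocycles F T n) <= \dim (coboundaries F T n) + c)%N.
  elim/ltn_ind: n => n IH n_gt0; have [le_nd|lt_dn] := leqP n d.
    by apply: leq_trans (leq_addl _ _); rewrite /c (bigD1 (Ordinal (le_nd : n < d.+1)%N)) ?leq_addr.
  rewrite -(subnK (ltnW lt_dn)); apply: (@cup_surjective_le _ _ eta).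
    have [g _ gK] := per (n - d)%N (etrans (subn_gt0 _ _) lt_dn).
    by move=> z; exists (g z); apply: gK.
  by apply: IH; rewrite ?subn_gt0 // ltn_subrL d_gt0 n_gt0.
have invE n : inv_cochains F [set: T] n = invariant_cochains F T n.
  by apply: eq_bigl => x; rewrite inE.
by move=> n; have := le n.+1 isT; rewrite /cohomology_le !invE.
Qed.

End Periodicity.

Lemma periodic_rank1 (p : nat) (gT : finGroupType) (G : {group gT}) (s t : gT) :
    prime p -> (p.-group G)%g -> has_periodic_cohomology p G ->
    s \in G -> t \in G -> commute s t -> #[s]%g = p -> #[t]%g = p ->
  t \in <[s]>%g.
Proof.
move=> p_pr pG [d [eta [d_gt0 per]]] Gs Gt cst os ot.
have [c le] := periodic_bounded d_gt0 per.
have char0 : p%:R = 0 :> 'F_p by apply: pcharf0; apply: pchar_Fp.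
have pT : (p.-group [set: subg_of G])%g by rewrite -(isog_pgroup p (isog_subg G)).
apply: contraT => nst.
have ord x : x \in G -> #[subg G x]%g = #[x]%g.
  by move=> Gx; apply: (order_injm (injm_subg G)).
have [c' le'] := @cohomology_le_subgroup _ _ _ p_pr char0 c <<[set subg G s; subg G t]>>%G pT le.
case: (rank2_unbounded p_pr char0 _ _ _ _ le'); rewrite ?ord //.
  by rewrite /commute -!morphM //= cst.
apply: contra nst => /cycleP[i tE]; apply/cycleP; exists i.
by rewrite -(subgK _ Gt) tE -(morphX _ i Gs) subgK ?groupX.
Qed.

Local Close Scope ring_scope.
Local Open Scope group_scope.

(** Let [z] be central of order [p]. By [periodic_rank1] every element of order
    [p] is a power of [z], and the [p]-groups with a single subgroup of order [p]
    are the cyclic and the generalized quaternion ones. *)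
Lemma periodic_cyclic_or_quaternion (p : nat) (gT : finGroupType) (G : {group gT}) :
    prime p -> p.-group G -> G :!=: 1 -> has_periodic_cohomology p G ->
  cyclic G || (p == 2) && (extremal_class G == Quaternion).
Proof.
move=> p_pr pG ntG per; apply/(prime_Ohm1P pG ntG).
have ntZ : 'Z(G) != 1 by rewrite center_nil_eq1 ?(pgroup_nil pG).
have [_ p_dvd _] := pgroup_pdiv (pgroupS (center_sub G) pG) ntZ.
have [z Zz oz] := Cauchy p_pr p_dvd; have /centerP[Gz cGz] := Zz.
suff -> : 'Ohm_1(G) = <[z]> by rewrite -orderE.
apply/eqP; rewrite eqEsubset cycle_subG (OhmE 1 pG) gen_subG; apply/andP; split.
  apply/subsetP => x; rewrite !inE => /andP[Gx x1].
  have [->|x_neq1] := eqVneq x 1; first exact: group1.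
  apply: (periodic_rank1 p_pr pG per Gz Gx) => //; first exact: cGz.
  by apply: nt_prime_order => //; apply/eqP; rewrite -[p]expn1.
by apply: mem_gen; rewrite !inE Gz {1}oz pdiv_id // expn1 -oz expg_order eqxx.
Qed.

Theorem theorem1p4 (p : nat) (gT : finGroupType) (G : {group gT}) :
  prime p -> p.-group G -> realizable G ->
  (almost_cyclic p G ->
     G \isog Zp 2 \/
     G \isog Zp 4 \/
     G \isog Zp 8 \/
     (exists q : nat, fermat_prime q /\ G \isog Zp (q - 1)%N) \/
     (exists n : nat, (1 <= n)%N /\ G \isog setX (Zp 2) (Zp (2 ^ n)%N)) \/
     (mersenne_prime p /\ G \isog Zp p) \/
     (mersenne_prime p /\ G \isog setX (Zp p) (Zp p)) \/
     G \isog 'D_8 \/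
     G \isog 'Q_8)
  /\
  (G :!=: 1 -> has_periodic_cohomology p G ->
     G \isog Zp 2 \/
     G \isog Zp 4 \/
     G \isog Zp 8 \/
     (mersenne_prime p /\ G \isog Zp p) \/
     (exists q : nat, fermat_prime q /\ G \isog Zp (q - 1)%N) \/
     G \isog 'Q_8).
Proof.
move=> p_pr pG realG; split=> [almG|ntG per].
  have [H [sHG cycH iGH]] := almG.
  have ntG : G :!=: 1.
    by apply: contraTneq (prime_gt1 p_pr) => G1; rewrite -leqNgt -iGH -divgS // G1 cards1 leq_div.
  have [cycG|ncycG] := boolP (cyclic G).
    case: (cyclic_realizable p_pr pG realG ntG cycG); last 2 first; [by tauto|by tauto|].
    by case=> k; case: k => [|[|[|[|]]]] //= _; tauto.
  have [p2|odd_p] := even_prime p_pr; last first.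
    by have := odd_almost_cyclic_realizable p_pr odd_p pG realG almG; tauto.
  rewrite p2 in pG iGH; have [abG|nabG] := boolP (abelian G).
    have [n n_gt0 isoG] := abelian_almost_cyclic2 pG abG ncycG sHG cycH iGH.
    by do 4!right; left; exists n.
  have oG := nonabelian_almost_cyclic2 pG realG nabG sHG cycH iGH.
  by have := extremal_order8 oG nabG sHG cycH iGH; tauto.
have [cycG|] := orP (periodic_cyclic_or_quaternion p_pr pG ntG per).
  case: (cyclic_realizable p_pr pG realG ntG cycG); last 2 first; [by tauto|by tauto|].
  by case=> k; case: k => [|[|[|[|]]]] //= _; tauto.
(* A generalized quaternion group is nonabelian and has a cyclic subgroup of
   index 2, so its order is 8. *)
case/andP=> /eqP p2 /eqP/quaternion_classP[n n_gt2 isoG].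
have [[x y] genG _] := generators_quaternion n_gt2 isoG.
have [oG Gx ox _] := genG; rewrite p2 in pG.
have n_gt0 : 0 < n by apply: ltn_trans n_gt2.
have sxG : <[x]> \subset G by rewrite cycle_subG.
have iGx : #|G : <[x]>| = 2.
  by rewrite -divgS // oG -orderE ox -{1}(prednK n_gt0) expnS mulnK // expn_gt0.
have nabG : ~~ abelian G.
  have [_ _ [_ oZ _ _ _] _ _] := quaternion_structure n_gt2 genG isoG.
  apply/negP => /center_idP ZG; move: oZ; rewrite ZG oG => /(@expnI 2 isT n 1%N) n1.
  by rewrite n1 in n_gt2.
have oG8 := nonabelian_almost_cyclic2 pG realG nabG sxG (cycle_cyclic x) iGx.
have n3 : n = 3 by apply: (@expnI 2 isT n 3); rewrite -oG oG8.
by rewrite n3 in isoG; do 5!right.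
Qed.
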